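(* Let $n\geqslant4$, let $\Gamma$ be an admissible graph with $n$ half-edges and let $(\ell_i)_{i=1,\dots,n}$ be a family of positive real numbers such that $\ell_j<\frac12(\ell_1+\cdots+\ell_n)$ for every $j$. The Hamiltonian flows on $\mathcal M^*_{\ell,\Gamma}$ of the functions $\frac12\lambda_a$, $a\in E_{\mathrm{int}}(\Gamma)$, mutually commute and are $2\pi$-periodic. Consequently they define an action of the torus $\mathbb T^{E_{\mathrm{int}}(\Gamma)}$ (where $\mathbb T=\mathbb R/2\pi\mathbb Z$) on $\mathcal M^*_{\ell,\Gamma}$. This action is free over $\mathcal M^{\mathrm{reg}}_{\ell,\Gamma}$. The fibres of $\lambda=(\lambda_a)_{a\in E_{\mathrm{int}}(\Gamma)}$ in $\mathcal M^{\mathrm{reg}}_{\ell,\Gamma}$ are the torus orbits.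
   Context: $\mathfrak{su}(2)$ has the scalar product $\langle\xi,\eta\rangle=-\frac12\operatorname{tr}(\xi\eta)$; $S^2_m\subset\mathfrak{su}(2)^*$ is the sphere of radius $m$ centered at the origin, with its coadjoint orbit symplectic form, of total volume $2\pi m$. The polygon space is the symplectic quotient $$\mathcal M_\ell=\{(x_1,\dots,x_n)\in S^2_{\ell_1}\times\cdots\times S^2_{\ell_n}\,/\;x_1+\cdots+x_n=0\}/SU(2).$$ $S_\ell\subset\mathcal M_\ell$ is the finite set of classes $[x_1,\dots,x_n]$ such that all the $x_i$ belong to the same line; $\mathcal M_\ell\setminus S_\ell$ is a symplectic manifold of dimension $2(n-3)$. The Hamiltonian vector field $X$ of $f$ is defined by $df+\omega(X,\cdot)=0$. An admissible graph is a connected, acyclic, trivalent graph, where edges with only one endpoint (half-edges) are permitted; the other edges are called internal edges. The half-edges are numbered $1,\dots,n$. $E_{\mathrm{int}}(\Gamma)$ and $E(\Gamma)$ are the sets of internal edges and of all edges. For an internal edge $a$, choose a direction and let $I(a)$ be the set of half-edges connected to the initial vertex of $a$ by a path not containing the terminal vertex of $a$. The function $\lambda_a([x_1,\dots,x_n])=|\sum_{i\in I(a)}x_i|$ does not depend on the direction. $\mathcal M^*_{\ell,\Gamma}$ is the subset of $\mathcal M_\ell\setminus S_\ell$ where none of the functions $\lambda_a$ vanishes; the $\lambda_a$ are smooth on it. $\Delta(\ell,\Gamma)\subset\mathbb R^{E_{\mathrm{int}}(\Gamma)}$ is the set of families $(d_a)_{a\in E_{\mathrm{int}}(\Gamma)}$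 of non-negative numbers such that, putting $d_i=\ell_i$ for each half-edge $i$, for any three mutually distinct edges $a,b,c$ incident to the same vertex one has $|d_a-d_b|\leqslant d_c\leqslant d_a+d_b$. $\mathcal M^{\mathrm{reg}}_{\ell,\Gamma}:=\lambda^{-1}(\operatorname{Int}\Delta(\ell,\Gamma))$, which is contained in $\mathcal M^*_{\ell,\Gamma}$. *)

(* Defs.v *)
From HB Require Import structures.
From mathcomp Require Import all_boot all_order all_algebra.
From mathcomp Require Import generic_quotient ring_quotient.
From mathcomp Require Import complex.
From mathcomp Require Import all_classical all_reals all_analysis.

Set Implicit Arguments.
Unset Strict Implicit.
Unset Printing Implicit Defensive.

Import Order.TTheory GRing.Theory Num.Theory.
Import numFieldNormedType.Exports.

Local Open Scope classical_set_scope.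
Local Open Scope complex_scope.
Local Open Scope sesquilinear_scope.
Local Open Scope quotient_scope.
Local Open Scope ring_scope.

(* ------------------------------------------------------------------------ *)
(* Throughout, su(2)^* is identified with su(2) by means of the scalar      *)
(* product sdot.  As sdot is Ad-invariant, the coadjoint action becomes     *)
(* x |-> g x g^-1 and its infinitesimal version becomes x |-> [xi, x].      *)
(* ------------------------------------------------------------------------ *)

Section Su2.
Variable R : realType.
Local Notation mat := 'M[R[i]]_2.

Definition su2 : set mat := [set x | x ^t* = - x /\ \tr x = 0].

Definition SU2 : set mat := [set g | g \is unitarymx /\ \det g = 1].

Definition bracket (x y : mat) : mat := x *m y - y *m x.

Definition coad (g x : mat) : mat := g *m x *m invmx g.

(* tr (x y) is real when x and y belong to su(2) *)
Definition sdot (x y : mat) : R := - (2^-1 * complex.Re (\tr (x *m y))).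

Definition snorm (x : mat) : R := Num.sqrt (sdot x x).

Definition sphere (m : R) : set mat := [set x | su2 x /\ snorm x = m].

(* Kirillov-Kostant-Souriau form of the coadjoint orbit of x: its value on  *)
(* ([xi, x], [eta, x]) is <x, [xi, eta]>, whatever the choice of xi, eta.   *)
Definition generator (x u : mat) : mat :=
  xget 0 [set xi | su2 xi /\ bracket xi x = u].

Definition kks (x u v : mat) : R :=
  sdot x (bracket (generator x u) (generator x v)).

End Su2.

Section PolygonSpace.
Variables (R : realType) (n : nat) (ell : 'I_n -> R).
Local Notation mat := 'M[R[i]]_2.

(* The zero level set of the moment map of prod_i S^2_(ell i). *)
Definition closed_polygon : Type :=
  {x : {ffun 'I_n -> mat} |
     `[< (forall i, sphere (ell i) (x i)) /\ \sum_i x i = 0 >]}.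

HB.instance Definition _ := Choice.on closed_polygon.

Definition congruent (x y : closed_polygon) : bool :=
  `[< exists2 g : mat, SU2 g & forall i, val y i = coad g (val x i) >].

Lemma SU2_unit (g : mat) : SU2 g -> g \in unitmx.
Proof. by case=> /unitarymx_unit. Qed.

Lemma SU2_1 : SU2 (1%:M : mat).
Proof.
split; last by rewrite det1.
by apply/unitarymxP; rewrite trmx1 map_mx1 mulmx1.
Qed.

Lemma SU2_M (g h : mat) : SU2 g -> SU2 h -> SU2 (g *m h).
Proof.
move=> [gU gD] [hU hD]; split; last by rewrite det_mulmx gD hD mulr1.
exact: mul_unitarymx.
Qed.

Lemma SU2_V (g : mat) : SU2 g -> SU2 (invmx g).
Proof.
move=> [gU gD]; split; last by rewrite det_inv gD invr1.
by rewrite invmx_unitary // trmxC_unitary.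
Qed.

Lemma coad1 (x : mat) : coad 1%:M x = x.
Proof. by rewrite /coad invmx1 mul1mx mulmx1. Qed.

Lemma coadM (g h x : mat) : SU2 g -> SU2 h -> coad (g *m h) x = coad g (coad h x).
Proof.
move=> /SU2_unit gU /SU2_unit hU; rewrite /coad.
have -> : invmx (g *m h) = invmx h *m invmx g.
  have ghU : g *m h \in unitmx by rewrite unitmx_mul gU.
  apply: (can_inj (mulKmx ghU)).
  by rewrite mulmxV // !mulmxA mulmxK // mulmxV.
by rewrite !mulmxA.
Qed.

Lemma congruent_equiv : equiv_class_of congruent.
Proof.
split.
- by move=> x; apply/asboolP; exists 1%:M; [exact: SU2_1|move=> i; rewrite coad1].
- have sym x y : congruent x y -> congruent y x.
    move=> /asboolP[g gU xy]; apply/asboolP; exists (invmx g); first exact: SU2_V.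
    move=> i; rewrite xy -coadM //; last exact: SU2_V.
    by rewrite mulVmx ?SU2_unit // coad1.
  by move=> x y; apply/idP/idP; exact: sym.
- move=> y x z /asboolP[g gU xy] /asboolP[h hU yz]; apply/asboolP.
  by exists (h *m g); [exact: SU2_M|move=> i; rewrite yz xy coadM].
Qed.

Canonical congruent_equiv_rel := EquivRelPack congruent_equiv.

Definition polygon_space : Type := {eq_quot congruent_equiv_rel}.

HB.instance Definition _ := Choice.on polygon_space.
HB.instance Definition _ := EqQuotient.on polygon_space.

Definition polygon_class (x : closed_polygon) : polygon_space :=
  \pi_polygon_space x.

Definition on_a_line (x : closed_polygon) : Prop :=
  exists u : mat, [/\ su2 u, u != 0 &
    forall i, exists k : R, val x i = k%:C *: u].

Definition singular_set : set polygon_space := polygon_class @` on_a_line.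

(* ------------------------------------------------------------------------ *)
(* Differential calculus on the complement of singular_set.  There the      *)
(* projection polygon_class is a submersion onto a manifold whose tangent   *)
(* space at the class of x is the quotient of the tangent space at x of the *)
(* level set by the one of the SU(2)-orbit of x; the reduced symplectic     *)
(* form is the one whose pull-back to the level set is the restriction of   *)
(* the product of the KKS forms.  A tangent vector at a class is given by a *)
(* representative x together with a vector u tangent to the level set at x. *)
(* ------------------------------------------------------------------------ *)

Definition tvec : Type := 'I_n -> mat.

Definition lift_velocity (c : R -> closed_polygon) (t : R) (u : tvec) : Prop :=
  forall i j k,
    is_derive t 1 (fun s => complex.Re (val (c s) i j k)) (complex.Re (u i j k)) /\
    is_derive t 1 (fun s => complex.Im (val (c s) i j k)) (complex.Im (u i j k)).

(* gamma is differentiable at t, and its velocity is the class of (x, u) *)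
Definition has_velocity (gamma : R -> polygon_space) (t : R)
    (x : closed_polygon) (u : tvec) : Prop :=
  exists c : R -> closed_polygon,
    [/\ c t = x, \forall s \near t, polygon_class (c s) = gamma s &
        lift_velocity c t u].

Definition reduced_form (x : closed_polygon) (u v : tvec) : R :=
  \sum_i kks (val x i) (u i) (v i).

(* The class of (x, X) is the value at the class of x of the Hamiltonian    *)
(* vector field of f, namely df + omega(X, .) = 0.                          *)
Definition hamiltonian_vector (f : polygon_space -> R)
    (x : closed_polygon) (X : tvec) : Prop :=
  (exists gamma, has_velocity gamma 0 x X) /\
  forall gamma w, has_velocity gamma 0 x w ->
    exists2 df : R, is_derive (0 : R) 1 (f \o gamma) df & df + reduced_form x X w = 0.

Definition integral_curve_at (U : set polygon_space) (f : polygon_space -> R)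
    (gamma : R -> polygon_space) (t : R) : Prop :=
  U (gamma t) /\
  exists x X, has_velocity gamma t x X /\ hamiltonian_vector f x X.

(* Phi is the complete flow on U of the Hamiltonian vector field of f:      *)
(* t |-> Phi t p is the maximal integral curve in U starting at p.  The     *)
(* values of Phi outside of U are irrelevant.                               *)
Definition hamiltonian_flow (U : set polygon_space) (f : polygon_space -> R)
    (Phi : R -> polygon_space -> polygon_space) : Prop :=
  forall p, U p ->
    [/\ Phi 0 p = p,
        forall t, integral_curve_at U f (Phi^~ p) t &
        forall (gamma : R -> polygon_space) (a b : R), a < 0 -> 0 < b ->
          gamma 0 = p ->
          (forall t, a < t -> t < b -> integral_curve_at U f gamma t) ->
          forall t, a < t -> t < b -> gamma t = Phi t p].

End PolygonSpace.

(* ------------------------------------------------------------------------ *)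
(* Since an acyclic graph has neither loops nor multiple edges, its         *)
(* internal edges are given by an irreflexive symmetric relation.           *)
(* ------------------------------------------------------------------------ *)

Record admissible_graph (n : nat) := AdmissibleGraph {
  vertex : finType;
  adj : rel vertex;
  half : 'I_n -> vertex; (* the endpoint of a half-edge *)
  adj_sym : symmetric adj;
  adj_irr : irreflexive adj;
  adj_connected : forall v w, connect adj v w;
  adj_acyclic : forall p : seq vertex, ucycle adj p -> (size p <= 2)%N;
  trivalent : forall v,
    (#|[set w | adj v w]%SET| + #|[set i | half i == v]%SET|)%N = 3
}.

Section Graph.
Variables (n : nat) (G : admissible_graph n).

Definition joins (d : vertex G * vertex G) (a : {set vertex G}) : bool :=
  adj d.1 d.2 && (a == [set d.1; d.2]%SET).

Definition Eint : finType := {a : {set vertex G} | [exists d, joins d a]}.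

Definition edge : Type := (Eint + 'I_n)%type.

Definition incident (v : vertex G) (a : edge) : Prop :=
  match a with
  | inl a => v \in val a
  | inr i => half G i = v
  end.

(* a choice of direction: (initial vertex, terminal vertex) *)
Definition direction (a : Eint) : vertex G * vertex G :=
  xchoose (existsP (valP a)).

Definition initial_half_edges (a : Eint) : {set 'I_n} :=
  let: (v, w) := direction a in
  [set i | (half G i != w) &&
           connect [rel x y | adj x y && (y != w)] (half G i) v]%SET.

End Graph.

Section Bending.
Variables (R : realType) (n : nat) (G : admissible_graph n) (ell : 'I_n -> R).

Definition lambda (a : Eint G) (p : polygon_space ell) : R :=
  snorm (\sum_(i in initial_half_edges a) val (repr p) i).

Definition Mstar : set (polygon_space ell) :=
  [set p | ~ singular_set p /\ forall a : Eint G, lambda a p <> 0].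

Definition edge_length (d : Eint G -> R) (a : edge G) : R :=
  match a with inl a => d a | inr i => ell i end.

Definition Delta : set {ptws Eint G -> R} :=
  [set d | (forall a, 0 <= d a) /\
     forall (v : vertex G) (a b c : edge G),
       incident v a -> incident v b -> incident v c ->
       a <> b -> b <> c -> a <> c ->
       `|edge_length d a - edge_length d b| <= edge_length d c
         <= edge_length d a + edge_length d b].

Definition Mreg : set (polygon_space ell) :=
  [set p | interior Delta (fun a => lambda a p)].

End Bending.

Arguments Mstar {R n} G ell.
Arguments Mreg {R n} G ell.

Section Torus.
Variable R : realType.

Definition period_lattice : {pred R} :=
  fun t => `[< exists k : int, t = (2 * pi) *~ k >].

Lemma period_lattice_zmod : zmod_closed period_lattice.
Proof.
split; first by apply/asboolP; exists 0.
move=> s t /asboolP[k ->] /asboolP[l ->]; apply/asboolP.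
by exists (k - l); rewrite mulrzBr.
Qed.

HB.instance Definition _ :=
  GRing.isZmodClosed.Build R period_lattice period_lattice_zmod.

(* the additive group R / 2 pi Z *)
Definition circle : zmodType := {ideal_quot period_lattice}.

Definition to_circle (t : R) : circle := \pi_({ideal_quot period_lattice}) t.

(* the element of the torus with coordinate t at a, and 0 elsewhere *)
Definition torus_coord (I : finType) (a : I) (t : R) : {ffun I -> circle} :=
  [ffun b => if b == a then to_circle t else 0].

End Torus.

(* Main.v *)
Require Import Defs.
From HB Require Import structures.
From mathcomp Require Import all_boot all_order all_algebra.
From mathcomp Require Import ring_quotient.
From mathcomp Require Import complex ring lra.
From mathcomp Require Import all_classical all_reals all_analysis.

Set Implicit Arguments.
Unset Strict Implicit.
Unset Printing Implicit Defensive.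

Import Order.TTheory GRing.Theory Num.Theory.
Import numFieldNormedType.Exports.

Local Open Scope classical_set_scope.
Local Open Scope ring_scope.

(** Identify [su(2)] with [R^3]: the scalar product becomes the dot product,
    the bracket becomes [-2] times the cross product, and [SU(2)] acts by all
    the rotations. If the edges of a polygon move under infinitesimal rotations
    [a_i], the reduced form pairs their velocity with a velocity [w] to the sum
    of the [<a_i, w_i>] ([reduced_formE]). Hence the Hamiltonian vector of half
    the length of a diagonal rotates the edges on one side of the diagonal about
    it, at unit angular speed ([bending_field_hamiltonian]). Its flow is the
    bending along the diagonal, which is explicit and visibly periodic.

    Integral curves are unique for the following reason. The reduced form is
    non-degenerate ([annihilator]), because two non-parallel edges can absorb
    any small motion of a third one ([triangle_deformation]). Therefore the
    velocity of a lift of an integral curve is that of the bending plus a global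
    infinitesimal rotation, and undoing the bending leaves a curve along which
    all scalar products and triple products of edges have zero derivative. These
    determine the class of a polygon whose edges are not collinear
    ([congruent_of_invariants]), so that the unbent curve is constant
    ([bend_hamiltonian_flow]).

    In the tree, the three edges at a vertex partition the half-edges, and every
    edge other than [a] has a side that does not contain [a]. So two bendings
    can be realised on nested or disjoint sets of edges, and commute
    ([Phi_comm]). The vertices of the tree are the triangles cut out by the
    diagonals, and an internal edge [a] is a hinge between two triangles.
    Bending along [a] by [t] turns this hinge by [t] and leaves the other hinges
    unchanged ([hinge_flow]). Over the regular part no triangle is flat, so that
    hinges have well-defined angles: the action is free. Moreover the lengths of
    the diagonals and the angles of the hinges determine the polygon up to
    congruence ([rigidity]), so that the torus is transitive on the fibres. *)

(** * Rotations of three-dimensional space *)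

Section Vectors.
Variable R : realType.

(** Triples of real numbers: an identity between vectors is proved coordinate
    by coordinate, as three polynomial identities ([vec_ring]). *)
Definition vec : lmodType R := (R^o * R^o * R^o)%type.

Implicit Types (u v w x y z : vec) (k t : R).

Definition cx v : R := v.1.1.
Definition cy v : R := v.1.2.
Definition cz v : R := v.2.
Definition mkvec (a b c : R) : vec := (a, b, c).

Definition dot v w : R := cx v * cx w + cy v * cy w + cz v * cz w.
Definition cross v w : vec :=
  mkvec (cy v * cz w - cz v * cy w) (cz v * cx w - cx v * cz w)
        (cx v * cy w - cy v * cx w).
Definition vnorm v : R := Num.sqrt (dot v v).
Definition normalize v : vec := (vnorm v)^-1 *: v.

(** Rodrigues' formula: the rotation by the angle [t] about the axis [u], when
    [u] is a unit vector. *)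
Definition turn u t v : vec :=
  cos t *: v + sin t *: cross u v + ((1 - cos t) * dot u v) *: u.

Lemma vec_ext v w : cx v = cx w -> cy v = cy w -> cz v = cz w -> v = w.
Proof. by case: v w => [[? ?] ?] [[? ?] ?]; rewrite /cx /cy /cz /= => -> -> ->. Qed.

Lemma cxD v w : cx (v + w) = cx v + cx w. Proof. by []. Qed.
Lemma cyD v w : cy (v + w) = cy v + cy w. Proof. by []. Qed.
Lemma czD v w : cz (v + w) = cz v + cz w. Proof. by []. Qed.
Lemma cxN v : cx (- v) = - cx v. Proof. by []. Qed.
Lemma cyN v : cy (- v) = - cy v. Proof. by []. Qed.
Lemma czN v : cz (- v) = - cz v. Proof. by []. Qed.
Lemma cxZ k v : cx (k *: v) = k * cx v. Proof. by []. Qed.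
Lemma cyZ k v : cy (k *: v) = k * cy v. Proof. by []. Qed.
Lemma czZ k v : cz (k *: v) = k * cz v. Proof. by []. Qed.
Lemma cxmk a b c : cx (mkvec a b c) = a. Proof. by []. Qed.
Lemma cymk a b c : cy (mkvec a b c) = b. Proof. by []. Qed.
Lemma czmk a b c : cz (mkvec a b c) = c. Proof. by []. Qed.
Lemma cx0 : cx 0 = 0. Proof. by []. Qed.
Lemma cy0 : cy 0 = 0. Proof. by []. Qed.
Lemma cz0 : cz 0 = 0. Proof. by []. Qed.

Definition coordE := (cxD, cyD, czD, cxN, cyN, czN, cxZ, cyZ, czZ,
  cxmk, cymk, czmk, cx0, cy0, cz0).

End Vectors.

Ltac vec_ring := (try apply: vec_ext); rewrite /turn /cross /dot ?coordE; ring.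

Section VectorTheory.
Variable R : realType.
Implicit Types (u v w x y z : vec R) (k t : R).

Lemma dotC v w : dot v w = dot w v. Proof. vec_ring. Qed.
Lemma dotDl v w x : dot (v + w) x = dot v x + dot w x. Proof. vec_ring. Qed.
Lemma dotDr v w x : dot x (v + w) = dot x v + dot x w. Proof. vec_ring. Qed.
Lemma dotZl k v w : dot (k *: v) w = k * dot v w. Proof. vec_ring. Qed.
Lemma dotZr k v w : dot v (k *: w) = k * dot v w. Proof. vec_ring. Qed.
Lemma dotNl v w : dot (- v) w = - dot v w. Proof. vec_ring. Qed.
Lemma dotNr v w : dot v (- w) = - dot v w. Proof. vec_ring. Qed.
Lemma dot0l v : dot 0 v = 0. Proof. vec_ring. Qed.
Lemma dot0r v : dot v 0 = 0. Proof. vec_ring. Qed.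

Lemma crossC v w : cross v w = - cross w v. Proof. vec_ring. Qed.
Lemma crossZl k v w : cross (k *: v) w = k *: cross v w. Proof. vec_ring. Qed.
Lemma crossZr k v w : cross v (k *: w) = k *: cross v w. Proof. vec_ring. Qed.
Lemma crossDl u v w : cross (u + v) w = cross u w + cross v w. Proof. vec_ring. Qed.
Lemma crossDr u v w : cross w (u + v) = cross w u + cross w v. Proof. vec_ring. Qed.
Lemma crossNl u v : cross (- u) v = - cross u v. Proof. vec_ring. Qed.
Lemma crossNr u v : cross u (- v) = - cross u v. Proof. vec_ring. Qed.
Lemma cross0r u : cross u 0 = 0. Proof. vec_ring. Qed.
Lemma crossvv u : cross u u = 0. Proof. vec_ring. Qed.
Lemma dot_cross_l v w : dot v (cross v w) = 0. Proof. vec_ring. Qed.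
Lemma dot_cross_r v w : dot w (cross v w) = 0. Proof. vec_ring. Qed.
Lemma dot_cross_rot u v w : dot u (cross v w) = dot v (cross w u).
Proof. vec_ring. Qed.
Lemma double_cross u v w : cross u (cross v w) = dot u w *: v - dot u v *: w.
Proof. vec_ring. Qed.
Lemma cross_sqr v w :
  dot (cross v w) (cross v w) = dot v v * dot w w - dot v w ^+ 2.
Proof. vec_ring. Qed.

Lemma dot_suml (I : Type) (r : seq I) (P : pred I) (F : I -> vec R) v :
  dot (\sum_(i <- r | P i) F i) v = \sum_(i <- r | P i) dot (F i) v.
Proof.
by apply: (big_morph (fun x => dot x v)) => [x y|]; rewrite ?dotDl ?dot0l.
Qed.

Lemma dot_sumr (I : Type) (r : seq I) (P : pred I) (F : I -> vec R) v :
  dot v (\sum_(i <- r | P i) F i) = \sum_(i <- r | P i) dot v (F i).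
Proof. by rewrite dotC dot_suml; apply: eq_bigr => i _; rewrite dotC. Qed.

Lemma cross_sumr (I : Type) (r : seq I) (P : pred I) (F : I -> vec R) v :
  cross v (\sum_(i <- r | P i) F i) = \sum_(i <- r | P i) cross v (F i).
Proof.
by apply: (big_morph (cross v)) => [x y|]; rewrite ?crossDr ?cross0r.
Qed.

Lemma dot_ge0 v : 0 <= dot v v.
Proof. by rewrite /dot !addr_ge0 // -expr2 sqr_ge0. Qed.

Lemma dot_eq0 v : (dot v v == 0) = (v == 0).
Proof.
apply/idP/idP => [|/eqP->]; last by rewrite dot0l.
rewrite /dot -!expr2 !paddr_eq0 ?addr_ge0 ?sqr_ge0 // !sqrf_eq0.
move=> /andP[/andP[/eqP h1 /eqP h2] /eqP h3].
by apply/eqP/vec_ext; rewrite ?coordE.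
Qed.

Lemma dot_gt0 v : (0 < dot v v) = (v != 0).
Proof. by rewrite lt0r dot_ge0 andbT dot_eq0. Qed.

Lemma vnorm_ge0 v : 0 <= vnorm v. Proof. exact: sqrtr_ge0. Qed.

Lemma vnorm_sqr v : vnorm v ^+ 2 = dot v v.
Proof. by rewrite sqr_sqrtr ?dot_ge0. Qed.

Lemma vnorm_eq0 v : (vnorm v == 0) = (v == 0).
Proof. by rewrite -sqrf_eq0 vnorm_sqr dot_eq0. Qed.

Lemma vnorm_gt0 v : (0 < vnorm v) = (v != 0).
Proof. by rewrite lt0r vnorm_ge0 andbT vnorm_eq0. Qed.

Lemma vnormN v : vnorm (- v) = vnorm v.
Proof. by rewrite /vnorm dotNl dotNr opprK. Qed.

Lemma normalize_unit v : v != 0 -> dot (normalize v) (normalize v) = 1.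
Proof.
move=> v0; rewrite /normalize dotZl dotZr -vnorm_sqr.
by rewrite expr2 mulKf ?vnorm_eq0 // mulVf ?vnorm_eq0.
Qed.

Lemma normalizeK v : v != 0 -> vnorm v *: normalize v = v.
Proof. by move=> v0; rewrite scalerA divff ?vnorm_eq0 // scale1r. Qed.

Lemma normalizeN v : normalize (- v) = - normalize v.
Proof. by rewrite /normalize vnormN scalerN. Qed.

(** The vectors [x], [y] and [cross x y] form a basis as soon as the last one
    is not zero; this is the expansion in the dual basis, up to the factor
    [dot n n]. *)
Lemma frame_expand x y z : let n := cross x y in
  dot n n *: z = dot z n *: n + dot z x *: cross y n + dot z y *: cross n x.
Proof. by rewrite /=; vec_ring. Qed.

Lemma frame_ext x y z z' : cross x y != 0 ->
  dot z x = dot z' x -> dot z y = dot z' y ->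
  dot z (cross x y) = dot z' (cross x y) -> z = z'.
Proof.
move=> n0 hx hy hn; move: n0; rewrite -dot_eq0 => n0.
by apply: (scalerI n0); rewrite !frame_expand hx hy hn.
Qed.

Lemma cross_eq0_collinear v w : v != 0 -> cross v w = 0 ->
  w = (dot v w / dot v v) *: v.
Proof.
move=> v0 vw; have /scalerI : dot v v != 0 by rewrite dot_eq0.
apply; have := double_cross v v w; rewrite vw cross0r => /eqP.
by rewrite eq_sym subr_eq0 => /eqP <-; rewrite scalerA mulrC divfK ?dot_eq0.
Qed.

Lemma cross_neq0_l v w : cross v w != 0 -> v != 0.
Proof.
by apply: contraNneq => ->; rewrite crossC cross0r oppr0.
Qed.

Lemma orthogonal_to_unit v :
  (forall e, dot e e = 1 -> dot e v = 0) -> v = 0.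
Proof.
move=> h; apply: contrapT => /eqP v0.
have := h _ (normalize_unit v0); rewrite dotZl => /eqP.
by rewrite mulf_eq0 invr_eq0 vnorm_eq0 dot_eq0 orbb (negbTE v0).
Qed.

(** Orientation preserving linear isometries. *)
Record is_rotation (T : vec R -> vec R) : Prop := IsRotation {
  rotationD : forall v w, T (v + w) = T v + T w;
  rotationZ : forall k v, T (k *: v) = k *: T v;
  rotation_dot : forall v w, dot (T v) (T w) = dot v w;
  rotation_cross : forall v w, cross (T v) (T w) = T (cross v w)
}.

Section IsRotation.
Variables (T : vec R -> vec R) (hT : is_rotation T).

Lemma rotation0 : T 0 = 0.
Proof. by have := rotationZ hT 0 0; rewrite !scale0r. Qed.

Lemma rotationN v : T (- v) = - T v.
Proof. by rewrite -scaleN1r (rotationZ hT) scaleN1r. Qed.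

Lemma rotation_sum (I : Type) (r : seq I) (P : pred I) (F : I -> vec R) :
  T (\sum_(i <- r | P i) F i) = \sum_(i <- r | P i) T (F i).
Proof. by apply: (big_morph T) => [x y|]; rewrite ?rotation0 ?(rotationD hT). Qed.

Lemma rotation_vnorm v : vnorm (T v) = vnorm v.
Proof. by rewrite /vnorm (rotation_dot hT). Qed.

Lemma rotation_normalize v : T (normalize v) = normalize (T v).
Proof. by rewrite /normalize (rotationZ hT) rotation_vnorm. Qed.

Lemma rotation_turn u t v : T (turn u t v) = turn (T u) t (T v).
Proof. by rewrite /turn !(rotationD hT) !(rotationZ hT) (rotation_cross hT) (rotation_dot hT). Qed.

Lemma rotation_eq0 v : (T v == 0) = (v == 0).
Proof. by rewrite -dot_eq0 (rotation_dot hT) dot_eq0. Qed.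

End IsRotation.

Section Rot.
Variable u : vec R.
Hypothesis u1 : dot u u = 1.

Let cs t : cos t ^+ 2 + sin t ^+ 2 - 1 = 0 :> R.
Proof. by rewrite cos2Dsin2 subrr. Qed.
Let uu : dot u u - 1 = 0.
Proof. by rewrite u1 subrr. Qed.

(** For a general vector [u], each identity about [turn u t] fails by a
    multiple of [dot u u - 1] or of [cos t ^+ 2 + sin t ^+ 2 - 1]; making that
    multiple explicit leaves a polynomial identity. *)
Lemma turn_isometric t v w : dot (turn u t v) (turn u t w) = dot v w.
Proof.
have -> : dot (turn u t v) (turn u t w) = dot v w
    + (cos t ^+ 2 + sin t ^+ 2 - 1) * (dot v w - dot u v * dot u w)
    + (dot u u - 1) *
      (sin t ^+ 2 * dot v w + (1 - cos t) ^+ 2 * dot u v * dot u w)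
  by vec_ring.
by rewrite cs uu !mul0r !addr0.
Qed.

Lemma turn_cross t v w : cross (turn u t v) (turn u t w) = turn u t (cross v w).
Proof.
have -> : cross (turn u t v) (turn u t w) = turn u t (cross v w)
    + (cos t ^+ 2 + sin t ^+ 2 - 1) *: (dot u (cross v w) *: u)
    + (dot u u - 1) *: ((cos t * (1 - cos t)) *: cross v w
        + (sin t * (1 - cos t)) *: cross u (cross v w))
  by vec_ring.
by rewrite cs uu !scale0r !addr0.
Qed.

Lemma turn_is_rotation t : is_rotation (turn u t).
Proof.
split; [by move=> v w; vec_ring|by move=> k v; vec_ring| |].
  exact: turn_isometric.
exact: turn_cross.
Qed.

Lemma turn_add s t v : turn u s (turn u t v) = turn u (s + t) v.
Proof.
have -> : turn u s (turn u t v) = turn u (s + t) v +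
    (dot u u - 1) *: ((- (sin s * sin t)) *: v
      + ((1 - cos s) * (1 - cos t) * dot u v) *: u).
  by rewrite /turn cosD sinD; vec_ring.
by rewrite uu scale0r addr0.
Qed.

Lemma turn_axis t k : turn u t (k *: u) = k *: u.
Proof.
have -> : turn u t (k *: u) = k *: u + (dot u u - 1) *: ((1 - cos t) * k *: u).
  by vec_ring.
by rewrite uu scale0r addr0.
Qed.

End Rot.

Lemma turn0 u v : turn u 0 v = v.
Proof. by rewrite /turn cos0 sin0; vec_ring. Qed.

Lemma turnNaxis u t v : turn (- u) t v = turn u (- t) v.
Proof. by rewrite /turn cosN sinN; vec_ring. Qed.

Lemma turn_periodic u t v : turn u (t + 2 * pi) v = turn u t v.
Proof. by rewrite /turn mulrC mulr_natr cosD2pi sinD2pi. Qed.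

End VectorTheory.

(** * Derivatives of moving vectors *)

Section VectorDerivative.
Variable R : realType.
Implicit Types (c d : R -> vec R) (f : R -> R) (u v w : vec R) (t : R).

Definition vderiv c t u : Prop :=
  [/\ is_derive t 1 (fun s => cx (c s)) (cx u),
      is_derive t 1 (fun s => cy (c s)) (cy u) &
      is_derive t 1 (fun s => cz (c s)) (cz u)].

Lemma is_derive_mul (f g : R -> R) t (a b : R) :
  is_derive t 1 f a -> is_derive t 1 g b ->
  is_derive t 1 (fun s => f s * g s) (f t * b + g t * a).
Proof. by move=> hf hg; apply: is_deriveM. Qed.

Lemma is_derive_add (f g : R -> R) t (a b : R) :
  is_derive t 1 f a -> is_derive t 1 g b ->
  is_derive t 1 (fun s => f s + g s) (a + b).
Proof. by move=> hf hg; apply: is_deriveD. Qed.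

Lemma is_derive_opp (f : R -> R) t (a : R) :
  is_derive t 1 f a -> is_derive t 1 (fun s => - f s) (- a).
Proof. by move=> hf; apply: is_deriveN. Qed.

Lemma is_derive_eqv (f : R -> R) t (a b : R) :
  is_derive t 1 f a -> a = b -> is_derive t 1 f b.
Proof. by move=> h <-. Qed.

Lemma is_derive_uniq (f : R -> R) t (a b : R) :
  is_derive t 1 f a -> is_derive t 1 f b -> a = b.
Proof. by move=> [_ <-] [_ <-]. Qed.

Lemma is_derive_const (a t : R) : is_derive t 1 (fun=> a) 0.
Proof. exact: is_derive_cst. Qed.

Lemma vderiv_eqv c t u v : vderiv c t u -> u = v -> vderiv c t v.
Proof. by move=> h <-. Qed.

Lemma vderiv_cst v t : vderiv (fun=> v) t 0.
Proof. by split; apply: is_derive_cst. Qed.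

Lemma vderivD c d t u v : vderiv c t u -> vderiv d t v ->
  vderiv (fun s => c s + d s) t (u + v).
Proof.
by move=> [? ? ?] [? ? ?]; split; apply: is_derive_add.
Qed.

Lemma vderivN c t u : vderiv c t u -> vderiv (fun s => - c s) t (- u).
Proof. by move=> [? ? ?]; split; apply: is_derive_opp. Qed.

Lemma vderivB c d t u v : vderiv c t u -> vderiv d t v ->
  vderiv (fun s => c s - d s) t (u - v).
Proof. by move=> hc hd; apply: vderivD hc (vderivN hd). Qed.

Lemma vderiv_sum (I : Type) (r : seq I) (P : pred I) (c : I -> R -> vec R)
    t (u : I -> vec R) : (forall i, vderiv (c i) t (u i)) ->
  vderiv (fun s => \sum_(i <- r | P i) c i s) t (\sum_(i <- r | P i) u i).
Proof.
move=> h; elim: r => [|i r IH].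
  under eq_fun do rewrite big_nil; rewrite big_nil; exact: vderiv_cst.
under eq_fun do rewrite big_cons; rewrite big_cons.
by case: (P i) => //; apply: vderivD.
Qed.

Lemma vderivZ f c t a u : is_derive t 1 f a -> vderiv c t u ->
  vderiv (fun s => f s *: c s) t (f t *: u + a *: c t).
Proof.
move=> hf [h1 h2 h3]; split;
  [apply: (is_derive_eqv (is_derive_mul hf h1))
  |apply: (is_derive_eqv (is_derive_mul hf h2))
  |apply: (is_derive_eqv (is_derive_mul hf h3))]; by rewrite !coordE; ring.
Qed.

Lemma is_derive_dot c d t u v : vderiv c t u -> vderiv d t v ->
  is_derive t 1 (fun s => dot (c s) (d s)) (dot u (d t) + dot (c t) v).
Proof.
move=> [h1 h2 h3] [k1 k2 k3].
apply: (is_derive_eqv (is_derive_add (is_derive_add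
  (is_derive_mul h1 k1) (is_derive_mul h2 k2)) (is_derive_mul h3 k3))).
by rewrite /dot; ring.
Qed.

Lemma vderiv_cross c d t u v : vderiv c t u -> vderiv d t v ->
  vderiv (fun s => cross (c s) (d s)) t (cross u (d t) + cross (c t) v).
Proof.
move=> [h1 h2 h3] [k1 k2 k3]; 
have minor f g f' g' a b a' b' : is_derive t 1 f a -> is_derive t 1 g b ->
    is_derive t 1 f' a' -> is_derive t 1 g' b' ->
    is_derive t 1 (fun s => f s * g s - f' s * g' s)
      (f t * b + g t * a - (f' t * b' + g' t * a')).
  move=> hf hg hf' hg'.
  exact: is_derive_add (is_derive_mul hf hg) (is_derive_opp (is_derive_mul hf' hg')).
by split; [apply: (is_derive_eqv (minor _ _ _ _ _ _ _ _ h2 k3 h3 k2))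
  |apply: (is_derive_eqv (minor _ _ _ _ _ _ _ _ h3 k1 h1 k3))
  |apply: (is_derive_eqv (minor _ _ _ _ _ _ _ _ h1 k2 h2 k1))];
  rewrite /cross !coordE; ring.
Qed.

Lemma is_derive_sqrt f t a : 0 < f t -> is_derive t 1 f a ->
  is_derive t 1 (fun s => Num.sqrt (f s)) (a / (2 * Num.sqrt (f t))).
Proof.
move=> ft hf; have h := is_derive1_sqrt ft.
by rewrite mulrC; exact: (is_derive1_comp h hf).
Qed.

Lemma is_derive_inv f t a : f t != 0 -> is_derive t 1 f a ->
  is_derive t 1 (fun s => (f s)^-1) (- (f t) ^- 2 * a).
Proof. by move=> ft hf; apply: is_deriveV. Qed.

Lemma is_derive_vnorm c t u : c t != 0 -> vderiv c t u ->
  is_derive t 1 (fun s => vnorm (c s)) (dot (normalize (c t)) u).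
Proof.
move=> ct hc; have hd := is_derive_dot hc hc.
have ct0 : 0 < dot (c t) (c t) by rewrite dot_gt0.
apply: (is_derive_eqv
  (@is_derive_sqrt (fun s => dot (c s) (c s)) t _ ct0 hd)).
rewrite dotC -/(vnorm _) dotZl; have := ct; rewrite -vnorm_eq0.
by move=> n0; field.
Qed.

Lemma is_derive_cosN t : is_derive t 1 (fun s : R => cos (- s)) (- sin t).
Proof.
under eq_fun do rewrite cosN; exact: is_derive_cos.
Qed.

Lemma is_derive_sinN t : is_derive t 1 (fun s : R => sin (- s)) (- cos t).
Proof.
under eq_fun do rewrite sinN; apply: is_derive_opp; exact: is_derive_sin.
Qed.

Lemma vderiv_turn u v t : dot u u = 1 ->
  vderiv (fun s => turn u s v) t (cross u (turn u t v)).
Proof.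
move=> u1; have h1 := is_derive_cos t; have h2 := is_derive_sin t.
have h3 := is_derive_add (is_derive_const 1 t) (is_derive_opp h1).
have hm : is_derive t 1 (fun s : R => (1 - cos s) * dot u v)
    ((1 - cos t) * 0 + dot u v * (0 - (- sin t))).
  exact: is_derive_mul h3 (is_derive_const (dot u v) t).
apply: vderiv_eqv.
  apply: vderivD; [apply: vderivD|].
  - exact: vderivZ h1 (vderiv_cst v t).
  - exact: vderivZ h2 (vderiv_cst (cross u v) t).
  - exact: vderivZ hm (vderiv_cst u t).
apply: (@etrans _ _ (cross u (turn u t v) + (dot u u - 1) *: (sin t *: v))).
  vec_ring.
by rewrite u1 subrr scale0r addr0.
Qed.

(** The infinitesimal rotation [e] transports the axis [a] along with [b], and
    the rotation of [b] about [a] is cancelled by the variation of the angle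
    [- s]. *)
Lemma vderiv_unrotate (a b : R -> vec R) t e :
  dot (a t) (a t) = 1 ->
  vderiv a t (cross e (a t)) ->
  vderiv b t (cross (a t) (b t) + cross e (b t)) ->
  vderiv (fun s => turn (a s) (- s) (b s)) t (cross e (turn (a t) (- t) (b t))).
Proof.
move=> a1 ha hb; have h1 := is_derive_cosN t; have h2 := is_derive_sinN t.
have h3 := is_derive_add (is_derive_const 1 t) (is_derive_opp h1).
have hd := is_derive_dot ha hb.
apply: vderiv_eqv.
  apply: vderivD; [apply: vderivD|].
  - exact: vderivZ h1 hb.
  - exact: vderivZ h2 (vderiv_cross ha hb).
  - exact: vderivZ (is_derive_mul h3 hd) ha.
apply: (@etrans _ _ (cross e (turn (a t) (- t) (b t))
    + (dot (a t) (a t) - 1) *: (sin t *: b t))).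
  by rewrite /turn cosN sinN; vec_ring.
by rewrite a1 subrr scale0r addr0.
Qed.

End VectorDerivative.

(** * The Lie algebra su(2) as a Euclidean space *)

Section Su2Vectors.
Local Open Scope complex_scope.
Local Open Scope sesquilinear_scope.
Variable R : realType.
Local Notation mat := 'M[R[i]]_2.
Implicit Types (u v w : vec R) (g x y : mat).

(** The coordinates of [su(2)] in the basis of the Pauli matrices multiplied
    by [i], in the order that makes the bracket equal to [-2] times the cross
    product. *)
Definition mx_of v : mat := \matrix_(i, j)
  if i == 0 then (if j == 0 then 0 +i* cx v else cz v +i* cy v)
  else (if j == 0 then (- cz v) +i* cy v else 0 +i* (- cx v)).

Definition vec_of x : vec R :=
  mkvec (complex.Im (x 0 0)) (complex.Im (x 0 1)) (complex.Re (x 0 1)).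

Lemma mx2P x y : x 0 0 = y 0 0 -> x 0 1 = y 0 1 -> x 1 0 = y 1 0 ->
  x 1 1 = y 1 1 -> x = y.
Proof.
move=> h00 h01 h10 h11; apply/matrixP.
have two (k : 'I_2) : k = 0 \/ k = 1.
  by case: k => [[|[|k]] hk] //; [left|right]; apply/val_inj.
by move=> i j; case: (two i) => ->; case: (two j) => ->.
Qed.

Lemma complexP (a b : R[i]) : complex.Re a = complex.Re b ->
  complex.Im a = complex.Im b -> a = b.
Proof. by case: a b => [? ?] [? ?] /= -> ->. Qed.

Lemma ReD (a b : R[i]) : complex.Re (a + b) = complex.Re a + complex.Re b.
Proof. by case: a b => [? ?] [? ?]. Qed.
Lemma ImD (a b : R[i]) : complex.Im (a + b) = complex.Im a + complex.Im b.
Proof. by case: a b => [? ?] [? ?]. Qed.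
Lemma ReN (a : R[i]) : complex.Re (- a) = - complex.Re a.
Proof. by case: a. Qed.
Lemma ImN (a : R[i]) : complex.Im (- a) = - complex.Im a.
Proof. by case: a. Qed.
Lemma ReM (a b : R[i]) : complex.Re (a * b) =
  complex.Re a * complex.Re b - complex.Im a * complex.Im b.
Proof. by case: a b => [? ?] [? ?]. Qed.
Lemma ImM (a b : R[i]) : complex.Im (a * b) =
  complex.Re a * complex.Im b + complex.Im a * complex.Re b.
Proof. by case: a b => [? ?] [? ?]. Qed.
Lemma Re_conj (a : R[i]) : complex.Re (a^*) = complex.Re a.
Proof. by case: a. Qed.
Lemma Im_conj (a : R[i]) : complex.Im (a^*) = - complex.Im a.
Proof. by case: a. Qed.
Definition ReImE := (ReD, ImD, ReN, ImN, ReM, ImM, Re_conj, Im_conj).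

Lemma mx2_mul x y (i j : 'I_2) : (x *m y) i j = x i 0 * y 0 j + x i 1 * y 1 j.
Proof. by rewrite mxE 2!big_ord_recl big_ord0 addr0; congr (_ + _ * _);
  congr (_ _ _); apply/val_inj. Qed.

Lemma mx2_sub x y (i j : 'I_2) : (x - y) i j = x i j - y i j.
Proof. by rewrite !mxE. Qed.

Lemma mx2_det x : \det x = x 0 0 * x 1 1 - x 0 1 * x 1 0.
Proof.
rewrite (expand_det_row _ 0) 2!big_ord_recl big_ord0 addr0 /cofactor !det_mx11.
rewrite !mxE.
have -> : lift (0 : 'I_2) (0 : 'I_1) = 1 by apply/val_inj.
have -> : lift (1 : 'I_2) (0 : 'I_1) = 0 by apply/val_inj.
by rewrite /= expr0 expr1 mul1r mulN1r mulrN.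
Qed.

Lemma mx2_trace x : \tr x = x 0 0 + x 1 1.
Proof.
rewrite /mxtrace 2!big_ord_recl big_ord0 addr0.
by congr (_ + _); congr (x _ _); apply/val_inj.
Qed.

Lemma mx_of00 v : mx_of v 0 0 = 0 +i* cx v. Proof. by rewrite mxE. Qed.
Lemma mx_of01 v : mx_of v 0 1 = cz v +i* cy v. Proof. by rewrite mxE. Qed.
Lemma mx_of10 v : mx_of v 1 0 = (- cz v) +i* cy v. Proof. by rewrite mxE. Qed.
Lemma mx_of11 v : mx_of v 1 1 = 0 +i* (- cx v). Proof. by rewrite mxE. Qed.
Definition mx_ofE := (mx_of00, mx_of01, mx_of10, mx_of11).

Lemma mx_ofK v : vec_of (mx_of v) = v.
Proof. by apply: vec_ext; rewrite /vec_of !mx_ofE. Qed.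

Lemma su2_mx_of v : su2 (mx_of v).
Proof.
split; last by rewrite mx2_trace !mx_ofE; apply: complexP; rewrite !ReImE /=; ring.
by apply: mx2P; apply: complexP; rewrite !mxE /= ?ReImE /= ?oppr0 ?opprK.
Qed.

Lemma su2P x : su2 x ->
  [/\ complex.Re (x 0 0) = 0, complex.Re (x 1 1) = 0,
      complex.Im (x 1 1) = - complex.Im (x 0 0),
      complex.Re (x 1 0) = - complex.Re (x 0 1) &
      complex.Im (x 1 0) = complex.Im (x 0 1)].
Proof.
move=> [xs]; rewrite mx2_trace => tr0.
have e i j : (x j i)^* = - x i j by have := congr1 (fun m : mat => m i j) xs; rewrite !mxE.
have := congr1 (@complex.Re R) (e 0 0); have := congr1 (@complex.Re R) (e 1 1).
have := congr1 (@complex.Re R) (e 1 0); have := congr1 (@complex.Im R) (e 1 0).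
have := congr1 (@complex.Im R) tr0.
rewrite !ReImE /= => h1 h2 h3 h4 h5; split; lra.
Qed.

Lemma su2_of_entries x :
  complex.Re (x 0 0) = 0 -> complex.Re (x 1 1) = 0 ->
  complex.Im (x 1 1) = - complex.Im (x 0 0) ->
  complex.Re (x 1 0) = - complex.Re (x 0 1) ->
  complex.Im (x 1 0) = complex.Im (x 0 1) -> mx_of (vec_of x) = x.
Proof.
move=> h1 h2 h3 h4 h5.
by apply: mx2P; apply: complexP; rewrite !mx_ofE /vec_of ?coordE /= ?h1 ?h2 ?h3 ?h4 ?h5.
Qed.

Lemma vec_ofK x : su2 x -> mx_of (vec_of x) = x.
Proof. by move=> /su2P[*]; apply: su2_of_entries. Qed.

Lemma mx_ofD v w : mx_of (v + w) = mx_of v + mx_of w.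
Proof.
by apply: mx2P; apply: complexP; rewrite [in RHS]mxE !mx_ofE !ReImE ?coordE /= ?coordE; ring.
Qed.

Lemma mx_ofZ (k : R) v : mx_of (k *: v) = k%:C *: mx_of v.
Proof.
by apply: mx2P; apply: complexP; rewrite [in RHS]mxE !mx_ofE !ReImE ?coordE /= ?coordE; ring.
Qed.

Lemma mx_of0 : mx_of 0 = 0.
Proof. by have := mx_ofZ 0 0; rewrite !scale0r. Qed.

Lemma mx_of_sum (I : Type) (r : seq I) (P : pred I) (F : I -> vec R) :
  mx_of (\sum_(i <- r | P i) F i) = \sum_(i <- r | P i) mx_of (F i).
Proof. by apply: (big_morph mx_of) => [x y|]; rewrite ?mx_of0 ?mx_ofD. Qed.

Lemma vec_ofD x y : vec_of (x + y) = vec_of x + vec_of y.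
Proof. by apply: vec_ext; rewrite /vec_of !mxE ?coordE !ReImE. Qed.

Lemma vec_ofZ (k : R) x : vec_of (k%:C *: x) = k *: vec_of x.
Proof. by apply: vec_ext; rewrite /vec_of !mxE ?coordE !ReImE /=; ring. Qed.

Lemma vec_of0 : vec_of 0 = 0.
Proof. by rewrite -mx_of0 mx_ofK. Qed.

Lemma vec_of_sum (I : Type) (r : seq I) (P : pred I) (F : I -> mat) :
  vec_of (\sum_(i <- r | P i) F i) = \sum_(i <- r | P i) vec_of (F i).
Proof. by apply: (big_morph vec_of) => [x y|]; rewrite ?vec_of0 ?vec_ofD. Qed.

Lemma sdot_mx_of v w : sdot (mx_of v) (mx_of w) = dot v w.
Proof.
rewrite /sdot mx2_trace !mx2_mul !ReImE !mx_ofE /= /dot; lra.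
Qed.

Lemma snorm_mx_of v : snorm (mx_of v) = vnorm v.
Proof. by rewrite /snorm sdot_mx_of. Qed.

Lemma bracket_mx_of v w : bracket (mx_of v) (mx_of w) = mx_of (- 2 *: cross v w).
Proof.
rewrite /bracket.
by apply: mx2P; rewrite mx2_sub !mx2_mul !mx_ofE; apply: complexP;
  rewrite !ReImE ?coordE /cross ?coordE /=; ring.
Qed.

(** The adjoint action of [g], read in [R^3]. *)
Definition ad g v : vec R := vec_of (coad g (mx_of v)).

Section Ad.
Variable g : mat.
Hypothesis gS : SU2 g.

Let gV : invmx g = g ^t*.
Proof. by case: gS => gU _; exact: invmx_unitary. Qed.

Let gunit : g \in unitmx := SU2_unit gS.

Lemma su2_coad x : su2 x -> su2 (coad g x).
Proof.
move=> [xs xt]; split; last by rewrite /coad mxtrace_mulC mulKmx.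
rewrite /coad gV !trmx_mul !map_mxM trmxCK xs mulNmx mulmxN.
by rewrite mulmxA.
Qed.

Lemma mx_of_ad v : mx_of (ad g v) = coad g (mx_of v).
Proof. exact: vec_ofK (su2_coad (su2_mx_of v)). Qed.

Lemma coadM_mul x y : coad g x *m coad g y = coad g (x *m y).
Proof. by rewrite /coad !mulmxA mulmxKV. Qed.

Lemma coadB x y : coad g (x - y) = coad g x - coad g y.
Proof. by rewrite /coad mulmxBr mulmxBl. Qed.

Lemma mx_of_inj : injective mx_of.
Proof. exact: can_inj mx_ofK. Qed.

(** Conjugation preserves traces of products and brackets, hence scalar
    products and cross products. *)
Lemma ad_is_rotation : is_rotation (ad g).
Proof.
split.
- by move=> v w; rewrite /ad mx_ofD /coad mulmxDr mulmxDl vec_ofD.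
- by move=> k v; rewrite /ad mx_ofZ /coad -scalemxAr -scalemxAl vec_ofZ.
- move=> v w; rewrite -!sdot_mx_of !mx_of_ad /sdot coadM_mul.
  by rewrite /coad mxtrace_mulC mulKmx.
move=> v w; have h : - 2 != 0 :> R by rewrite oppr_eq0 pnatr_eq0.
apply: (scalerI h); apply: mx_of_inj; rewrite -bracket_mx_of !mx_of_ad.
rewrite /bracket !coadM_mul -coadB -/(bracket _ _) bracket_mx_of.
by rewrite !mx_ofZ mx_of_ad /coad -scalemxAr -scalemxAl.
Qed.

End Ad.

Lemma ad_mul g h v : SU2 g -> SU2 h -> ad (g *m h) v = ad g (ad h v).
Proof.
move=> gS hS; rewrite /ad (coadM _ gS hS); congr (vec_of (coad g _)).
by rewrite (vec_ofK (su2_coad hS (su2_mx_of v))).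
Qed.

Lemma mx_of_anticomm u v :
  mx_of u *m mx_of v = - (mx_of v *m mx_of u) - (2 * dot u v)%:C%:M.
Proof.
by apply: mx2P; rewrite mx2_sub [(- _ : mat) _ _]mxE !mx2_mul !mx_ofE !mxE;
  apply: complexP; rewrite !ReImE /dot /=; ring.
Qed.

Lemma mx_of_sqr u : mx_of u *m mx_of u = - (dot u u)%:C%:M.
Proof.
by apply: mx2P; rewrite [(- _ : mat) _ _]mxE !mx2_mul !mx_ofE !mxE;
  apply: complexP; rewrite !ReImE /dot /=; ring.
Qed.

(** The square of [mx_of u] is [-1], so that this matrix belongs to [SU(2)]
    and is inverted by a change of sign; it anticommutes with [mx_of v] up to
    a scalar, which gives the conjugate of [mx_of v]. *)
Lemma half_turn u : dot u u = 1 ->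
  SU2 (mx_of u) /\ forall v, ad (mx_of u) v = (2 * dot u v) *: u - v.
Proof.
move=> u1; have uu : mx_of u *m mx_of u = - 1%:M by rewrite mx_of_sqr u1.
have uS : SU2 (mx_of u).
  split; last first.
    rewrite mx2_det !mx_ofE; apply: complexP; rewrite !ReImE /= -?u1 /dot; ring.
  by apply/unitarymxP; have [-> _] := su2_mx_of u; rewrite mulmxN uu opprK.
split=> // v; have uV : invmx (mx_of u) = - mx_of u.
  apply: (can_inj (mulKmx (SU2_unit uS))).
  by rewrite mulmxV ?(SU2_unit uS) // mulmxN uu opprK.
apply: mx_of_inj; rewrite mx_of_ad // /coad uV mulmxN mx_of_anticomm.
rewrite mulmxBl mulNmx opprB -mulmxA uu mulmxN opprK mulmx1 mul_scalar_mx.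
by rewrite mx_ofD mx_ofZ -scaleN1r mx_ofZ rmorphN1 scaleN1r.
Qed.

End Su2Vectors.

(** * Transitivity of SU(2) on frames *)

Section SU2Transitivity.
Local Open Scope complex_scope.
Variable R : realType.
Implicit Types (u v w x y : vec R) (g h : 'M[R[i]]_2).

Lemma half_turn_axis u v : dot (normalize u) v = 0 ->
  (2 * dot (normalize u) v) *: normalize u - v = - v.
Proof. by move=> ->; rewrite mulr0 scale0r sub0r. Qed.

Lemma half_turn_bisector v w : dot v v = dot w w -> v + w != 0 ->
  let u := normalize (v + w) in (2 * dot u v) *: u - v = w.
Proof.
move=> vw n0 /=; rewrite /normalize dotZl scalerA.
suff -> : 2 * ((vnorm (v + w))^-1 * dot (v + w) v) / vnorm (v + w) = 1.
  by rewrite scale1r addrC addKr.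
have h : 2 * dot (v + w) v = vnorm (v + w) ^+ 2.
  by rewrite vnorm_sqr !dotDl !dotDr (dotC w v) -vw; ring.
rewrite mulrCA h expr2 mulKf ?divff // vnorm_eq0 //.
Qed.

(** The half-turn about the bisector of [x] and [y] does it, or, if [y = - x],
    the half-turn about any axis orthogonal to [x]; such an axis is [cross x
    v]. *)
Lemma SU2_transitive x y v : cross x v != 0 -> dot x x = dot y y ->
  exists2 g, SU2 g & ad g x = y.
Proof.
move=> xv xy; case: (eqVneq (x + y) 0) => [xy0|n0]; last first.
  have [gS ha] := half_turn (normalize_unit n0).
  by exists (mx_of (normalize (x + y))); rewrite // ha half_turn_bisector.
have [gS ha] := half_turn (normalize_unit xv).
exists (mx_of (normalize (cross x v))); rewrite // ha half_turn_axis.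
  by apply/eqP; rewrite eq_sym -addr_eq0 addrC xy0.
by rewrite dotZl dotC dot_cross_l mulr0.
Qed.

(** Send [x] to [- x'] first: the remaining motion reverses the first vector
    of a pair, hence can be achieved by a half-turn about an axis orthogonal
    to [x']. *)
Lemma SU2_transitive_frames x y x' y' : cross x y != 0 ->
  dot x x = dot x' x' -> dot y y = dot y' y' -> dot x y = dot x' y' ->
  exists2 g, SU2 g & ad g x = x' /\ ad g y = y'.
Proof.
move=> n0 hx hy hxy.
have [|g1 g1S g1x] := @SU2_transitive x (- x') y n0.
  by rewrite dotNl dotNr opprK.
have R1 := ad_is_rotation g1S; set y1 := ad g1 y.
have hy1 : dot y1 y1 = dot y' y' by rewrite /y1 (rotation_dot R1).
have hxy1 : dot x' y1 = - dot x' y'.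
  by rewrite -hxy -(rotation_dot R1 x y) g1x dotNl opprK.
have n1 : cross x' y' != 0.
  by rewrite -dot_eq0 cross_sqr -hx -hy -hxy -cross_sqr dot_eq0.
suff [g2 g2S [e1 e2]] : exists2 g, SU2 g & ad g (- x') = x' /\ ad g y1 = y'.
  exists (g2 *m g1); first exact: SU2_M.
  by rewrite !ad_mul // g1x e1 e2.
case: (eqVneq (y1 + y') 0) => [yy|n2].
  have [gS ha] := half_turn (normalize_unit n1).
  exists (mx_of (normalize (cross x' y'))) => //; rewrite !ha.
  have -> : y1 = - y' by apply/eqP; rewrite -addr_eq0 yy.
  rewrite !half_turn_axis ?opprK // dotZl dotC dotNl.
    by rewrite dot_cross_r oppr0 mulr0.
  by rewrite dot_cross_l oppr0 mulr0.
have [gS ha] := half_turn (normalize_unit n2).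
exists (mx_of (normalize (y1 + y'))) => //; rewrite !ha half_turn_bisector //.
rewrite half_turn_axis ?opprK // dotZl dotC dotNl dotDr hxy1 addNr.
by rewrite oppr0 mulr0.
Qed.

Lemma rotation_ext (S T : vec R -> vec R) x y : is_rotation S -> is_rotation T ->
  cross x y != 0 -> S x = T x -> S y = T y -> S =1 T.
Proof.
move=> hS hT n0 ex ey v.
have n1 : cross (S x) (S y) != 0.
  by rewrite (rotation_cross hS) (rotation_eq0 hS).
apply: (frame_ext n1); rewrite ?(rotation_cross hS) (rotation_dot hS).
- by rewrite ex (rotation_dot hT).
- by rewrite ey (rotation_dot hT).
by rewrite -(rotation_cross hS) ex ey (rotation_cross hT) (rotation_dot hT).
Qed.

(** An element of [SU(2)] that acts as [T] on two independent vectors acts as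
    [T] on their cross product, hence everywhere. *)
Lemma rotation_is_ad (T : vec R -> vec R) : is_rotation T -> exists2 g, SU2 g & T =1 ad g.
Proof.
move=> hT; pose e1 : vec R := mkvec 1 0 0; pose e2 : vec R := mkvec 0 1 0.
have n0 : cross e1 e2 != 0.
  rewrite -dot_eq0.
  have -> : dot (cross e1 e2) (cross e1 e2) = 1.
    by rewrite /cross /dot ?coordE; ring.
  exact: oner_neq0.
have [||| g gS [h1 h2]] := @SU2_transitive_frames e1 e2 (T e1) (T e2) n0;
  rewrite ?(rotation_dot hT) //.
by exists g => //; apply: (rotation_ext hT (ad_is_rotation gS) n0).
Qed.

(** Scalar products and triple products separate the orbits of [SU(2)] on the
    families of vectors that span at least a plane: some rotation matches two
    independent vectors, and every other vector is determined by its products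
    with these two and with their cross product. *)
Lemma congruent_of_invariants (I : Type) (X Y : I -> vec R) j k :
  cross (X j) (X k) != 0 ->
  (forall i i', dot (X i) (X i') = dot (Y i) (Y i')) ->
  (forall i i' i'', dot (X i) (cross (X i') (X i'')) =
                    dot (Y i) (cross (Y i') (Y i''))) ->
  exists2 g, SU2 g & forall i, Y i = ad g (X i).
Proof.
move=> n0 h2 h3.
have [g gS [e1 e2]] := SU2_transitive_frames n0 (h2 j j) (h2 k k) (h2 j k).
have Rg := ad_is_rotation gS; exists g => // i.
have n1 : cross (Y j) (Y k) != 0.
  by rewrite -e1 -e2 (rotation_cross Rg) (rotation_eq0 Rg).
apply: (frame_ext n1).
- by rewrite -h2 -e1 (rotation_dot Rg).
- by rewrite -h2 -e2 (rotation_dot Rg).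
by rewrite -h3 -e1 -e2 (rotation_cross Rg) (rotation_dot Rg).
Qed.

End SU2Transitivity.

(** * Branches of a trivalent tree *)

Section Tree.
Import boot.fintype boot.finset.
Variables (n : nat) (G : admissible_graph n).
Local Notation V := (vertex G).
Implicit Types (v w p q x y z : V) (a b : Eint G).

Definition cut v : rel V := fun x y => [&& adj x y, x != v & y != v].
Arguments cut v x y /.

(** The connected component of [w] once the vertex [v] is removed. *)
Definition branch v w : {set V} :=
  [set z | (z != v) && connect (cut v) z w]%SET.

Lemma cut_sym v : connect_sym (cut v).
Proof.
apply: sym_connect_sym => x y /=.
by rewrite adj_sym [(x != v) && _]andbC.
Qed.

Lemma adj_neq v w : adj v w -> v != w.
Proof. by apply: contraTneq => ->; rewrite adj_irr. Qed.

Lemma avoid_cut v w z :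
  (z != v) && connect [rel x y | adj x y && (y != v)] z w = (z \in branch v w).
Proof.
rewrite inE; case: (eqVneq z v) => //= zv; apply/idP/idP; last first.
  by apply: connect_sub => x y /= /and3P[xy xv yv]; rewrite connect1 //= xy.
move=> /connectP[s + ->]; elim: s z zv => [|y s IH] z zv /=.
  by rewrite connect0.
move=> /andP[/andP[zy yv] ys]; apply: connect_trans (IH _ yv ys).
by rewrite connect1 //= zy zv.
Qed.

Lemma branch_refl v w : adj v w -> w \in branch v w.
Proof. by move=> vw; rewrite inE connect0 andbT eq_sym adj_neq. Qed.

(** A path from [z] to [v] enters [v] through a neighbour. *)
Lemma branch_exists v z : z != v -> exists2 w, adj v w & z \in branch v w.
Proof.
move=> zv; have /connectP[s] := adj_connected z v.
elim: s z zv => [|y s IH] z zv /=; first by move=> _ e; rewrite e eqxx in zv.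
move=> /andP[zy ys] ev; case: (eqVneq y v) => [yv|yv].
  exists z; first by rewrite adj_sym -yv.
  by rewrite inE zv connect0.
have [w vw] := IH _ yv ys ev; rewrite inE yv /= => yw; exists w => //.
by rewrite inE zv (connect_trans _ yw) // connect1 //= zy zv.
Qed.

(** Two neighbours of [v] joined by a path that avoids [v] would close up to a
    cycle. *)
Lemma branch_unique v w w' z : adj v w -> adj v w' ->
  z \in branch v w -> z \in branch v w' -> w = w'.
Proof.
move=> vw vw'; rewrite !inE => /andP[_ zw] /andP[_ zw'].
have {zw zw'} : connect (cut v) w w'.
  by apply: connect_trans zw'; rewrite cut_sym.
case: (eqVneq w w') => // ww' /connectP[s ws ew].
case/shortenP: ws ew => {s} s ws us _ ew.
have sub : path (@adj _ G) w s by apply: sub_path ws => x y /= /and3P[].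
have vs : v \notin w :: s.
  rewrite inE negb_or adj_neq //=; elim: s w ws {us ew sub vw ww'} => //= y s IH w.
  by move=> /andP[/and3P[_ _ yv] ys]; rewrite inE eq_sym negb_or yv /= (IH y).
have := @adj_acyclic _ G (v :: w :: s).
rewrite /ucycle (cons_uniq v) vs us /= andbT rcons_path sub vw -ew adj_sym vw' /=.
by move=> /(_ isT); case: s ew {ws us sub vs} => //= e; rewrite e eqxx in ww'.
Qed.

(** Removing the edge between [v] and [w] cuts the tree in two. If [z] were on
    both sides, a path from [z] to [w] that avoids [v] would enter [w] through
    a neighbour other than [v], in the branch of [v]. If [z] were on neither
    side, its branch at [v] would lead to [v] without meeting [w]. *)
Lemma branch_compl v w : adj v w -> branch w v = ~: branch v w.
Proof.
move=> vw; have wv : adj w v by rewrite adj_sym.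
have nvw := adj_neq vw; apply/setP => z; rewrite in_setC.
apply/idP/idP => [zv|].
  apply/negP; rewrite !inE => /andP[nzv /connectP[s zs es]].
  suff [w1 [ww1 w1v zw1]] : exists w1, [/\ adj w w1, w1 != v & z \in branch w w1].
    by rewrite (branch_unique ww1 wv zw1 zv) eqxx in w1v.
  have : z != w by move: zv; rewrite inE => /andP[].
  move=> {zv nzv}; elim: s z zs es => [|y s IH] z /=.
    by move=> _ <-; rewrite eqxx.
  move=> /andP[/and3P[zy zv yv] ys] es zw; case: (eqVneq y w) => [yw|yw].
    by exists z; rewrite -{1}yw adj_sym zv inE zw connect0.
  have [w1 [ww1 w1v]] := IH _ ys es yw; rewrite inE => /andP[_ yw1].
  exists w1; split=> //; rewrite inE zw (connect_trans _ yw1) // connect1 //=.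
  by rewrite zy zw.
case: (eqVneq z v) => [-> _|zv zw]; first exact: branch_refl.
have [w' vw' zw'] := branch_exists zv.
move: (zw'); rewrite inE zv /= => /connectP[s zs es].
have nzw : z != w by apply: contraNneq zw => ->; exact: branch_refl.
suff zw'' : connect (cut w) z w'.
  have nw : w' != w by apply: contraNneq zw => <-.
  rewrite inE nzw (connect_trans zw'') // connect1 //= nw adj_sym vw'.
  exact: nvw.
elim: s z zs es zw nzw {zv zw'} => [|y s IH] z /=; first by move=> _ -> *; exact: connect0.
move=> /andP[/and3P[zy zv yv] ys] es zw nzw.
have yw : y \notin branch v w.
  apply: contra zw; rewrite !inE zv yv => /= /(connect_trans _); apply.
  by rewrite connect1 //= zy zv.
have nyw : y != w by apply: contraNneq yw => ->; exact: branch_refl.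
apply: connect_trans (IH _ ys es yw nyw).
by rewrite connect1 //= zy nzw.
Qed.

Lemma branch_connect p q v z : v \notin branch p q -> z \in branch p q ->
  connect (cut v) z q.
Proof.
move=> vb; rewrite inE => /andP[zp /connectP[s zs es]].
elim: s z zp zs es => [|y s IH] z zp /=; first by move=> _ ->; exact: connect0.
move=> /andP[/and3P[zy _ yp] ys] es; apply: connect_trans (IH _ yp ys es).
have yq : connect (cut p) y q by apply/connectP; exists s.
have yb : y \in branch p q by rewrite inE yp.
have zb : z \in branch p q.
  by rewrite inE zp (connect_trans _ yq) // connect1 //= zy zp.
by rewrite connect1 //= zy /=; apply/andP; split; apply: contraNneq vb => <-.
Qed.

(** A branch that misses [v] is connected, hence lies in one component of the
    complement of [v]. *)
Lemma branch_away p q v w z z' : v \notin branch p q ->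
  z \in branch p q -> z' \in branch p q -> z \in branch v w -> z' \in branch v w.
Proof.
move=> vb zb z'b; rewrite !inE => /andP[_ zw]; apply/andP; split.
  by apply: contraNneq vb => <-.
apply: connect_trans (branch_connect vb z'b) (connect_trans _ zw).
by rewrite cut_sym (branch_connect vb zb).
Qed.

(** A flag at a vertex is one of its three edges, given by the neighbour that
    it leads to or by the number of the half-edge. *)
Definition flag : finType := (V + 'I_n)%type.
Implicit Types (f g : flag).

Definition star v f : bool :=
  match f with inl w => adj v w | inr i => Defs.half G i == v end.

(** The half-edges beyond [f] when seen from [v]; for an internal edge, this
    is the set of the half-edges on one of its two sides. *)
Definition tips v f : {set 'I_n} :=
  match f with
  | inl w => [set i | Defs.half G i \in branch v w]%SET
  | inr i => [set i]%SET
  end.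

(** The flags at [v] partition the half-edges: existence and uniqueness of the
    branch that carries the half-edge [i]. *)
Lemma tips_unique v (i : 'I_n) :
  exists f0, forall f, (star v f && (i \in tips v f)) = (f == f0).
Proof.
case: (eqVneq (Defs.half G i) v) => [iv|iv].
  exists (inr i) => -[w|j] /=; first by rewrite inE inE iv eqxx andbF.
  rewrite inE [RHS](inj_eq inr_inj) [i == j]eq_sym.
  by case: (eqVneq j i) => [->|_]; rewrite ?andbF // iv eqxx.
have [w0 vw0 iw0] := branch_exists iv; exists (inl w0) => -[w|j] /=.
  rewrite inE [RHS](inj_eq inl_inj); apply/andP/eqP => [[vw iw]|->] //.
  exact: branch_unique vw vw0 iw iw0.
by rewrite inE; apply/negP => /andP[/eqP jv /eqP ij]; rewrite ij jv eqxx in iv.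
Qed.

Lemma tips_disjoint v f g : star v f -> star v g -> f != g ->
  tips v f \subset ~: tips v g.
Proof.
move=> vf vg fg; apply/subsetP => i fi; rewrite in_setC; apply/negP => gi.
have [f0 h] := tips_unique v i; have := h f; have := h g.
rewrite vf vg fi gi /= => /esym/eqP eg /esym/eqP ef.
by rewrite ef eg eqxx in fg.
Qed.

Lemma star_sum (M : zmodType) v (X : 'I_n -> M) :
  \sum_(f | star v f) \sum_(i in tips v f) X i = \sum_i X i.
Proof.
rewrite (exchange_big_dep xpredT) //=; apply: eq_bigr => i _.
have [f0 h] := tips_unique v i.
by under eq_bigl do rewrite h; rewrite big_pred1_eq.
Qed.

Lemma card_star v : #|star v| = 3.
Proof.
rewrite -(trivalent v) -!sum1_card big_sumType /=.
by congr (_ + _)%N; apply: eq_bigl => x; rewrite inE.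
Qed.

Lemma star3 v f : star v f -> exists f' f'', [/\ star v f', star v f'',
  uniq [:: f; f'; f''] & forall g, star v g -> g \in [:: f; f'; f'']].
Proof.
move=> vf.
have c2 : #|[predD1 star v & f]| = 2.
  by have := card_star v; rewrite (cardD1 f) [f \in _]vf => -[].
have /card_gt0P[f' hf'] : (0 < #|[predD1 star v & f]|)%N by rewrite c2.
have c1 : #|[predD1 [predD1 star v & f] & f']| = 1.
  by have := c2; rewrite (cardD1 f') hf' => -[].
have /card_gt0P[f'' hf''] : (0 < #|[predD1 [predD1 star v & f] & f']|)%N.
  by rewrite c1.
have c0 : #|[predD1 [predD1 [predD1 star v & f] & f'] & f'']| = 0.
  by have := c1; rewrite (cardD1 f'') hf'' => -[].
move: hf' hf''; rewrite !inE => /andP[n1 s1] /and3P[n2 n3 s2].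
exists f', f''; split => //.
  by rewrite /= !inE negb_or [f == _]eq_sym n1 [f == f'']eq_sym n3 [f' == _]eq_sym n2.
move=> g vg; have := card0_eq c0 g; rewrite !inE.
by case: (g == f) => //; case: (g == f') => //; case: (g == f'') => //=; rewrite [g \in _]vg.
Qed.

Lemma star3_sum (M : zmodType) v f f' f'' (X : 'I_n -> M) :
  star v f -> star v f' -> star v f'' -> uniq [:: f; f'; f''] ->
  \sum_(i in tips v f) X i + \sum_(i in tips v f') X i
    + \sum_(i in tips v f'') X i = \sum_i X i.
Proof.
move=> vf vf' vf'' u; rewrite -(star_sum v).
have -> : \sum_(g | star v g) \sum_(i in tips v g) X i =
    \sum_(g <- [:: f; f'; f'']) \sum_(i in tips v g) X i.
  rewrite [RHS]big_uniq //=; apply: eq_bigl => g.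
  have sub : {subset [:: f; f'; f''] <= star v}.
    by move=> h; rewrite !inE => /or3P[] /eqP->.
  have /subset_cardP h : #|[:: f; f'; f'']| = #|star v|.
    by rewrite card_star (card_uniqP u).
  by rewrite (h _ g) //; apply/subsetP.
by rewrite !big_cons big_nil addr0 addrA.
Qed.

Lemma tips_compl v w : adj v w -> tips w (inl v) = ~: tips v (inl w).
Proof. by move=> vw; apply/setP => i; rewrite in_setC ![i \in _]inE branch_compl // in_setC. Qed.

(** This dichotomy makes the bendings along distinct edges commute and
    preserve the lengths of all the diagonals. *)
Lemma tips_away p q v f : v \notin branch p q -> star v f ->
  tips p (inl q) \subset tips v f \/ tips p (inl q) \subset ~: tips v f.
Proof.
move=> vb; case: f => [w|j] vf.
  case: (boolP (tips p (inl q) \subset ~: tips v (inl w))) => [h|h]; first by right.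
  have /fintype.subsetPn[i ip iv] := h; move: ip iv.
  rewrite in_setC negbK ![i \in _]inE => ip iv; left; apply/subsetP => j.
  by rewrite ![j \in _]inE => jp; apply: branch_away vb ip jp iv.
right; apply/subsetP => i; rewrite in_setC [i \in tips _ _]inE in_set1.
by move=> ip; apply: contraNneq vb => ij; rewrite -(eqP vf) -ij.
Qed.

(** The two orientations of an internal edge play symmetric roles, unlike in
    [direction]. *)
Definition ends a v w : bool := adj v w && (val a == [set v; w]%SET).

Lemma ends_adj a v w : ends a v w -> adj v w. Proof. by case/andP. Qed.

Lemma ends_sym a v w : ends a v w -> ends a w v.
Proof. by rewrite /ends adj_sym setUC. Qed.

Lemma ends_exist a : exists v w, ends a v w.
Proof.
have := xchooseP (existsP (valP a)); rewrite -/(direction a) => h.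
by exists (direction a).1, (direction a).2.
Qed.

Lemma edge_between v w : adj v w -> exists a, ends a v w.
Proof.
move=> vw; have h : [exists d, joins d [set v; w]%SET].
  by apply/existsP; exists (v, w); rewrite /joins /= vw eqxx.
by exists (exist (fun e : {set V} => is_true [exists d, joins d e]) _ h); rewrite /ends vw /= eqxx.
Qed.

Lemma set2_eq v w p q : v != w -> [set v; w]%SET = [set p; q]%SET ->
  (v = p /\ w = q) \/ (v = q /\ w = p).
Proof.
move=> vw e; have := set21 v w; have := set22 v w.
rewrite e !inE => /orP[]/eqP hw /orP[]/eqP hv.
- by rewrite hv hw eqxx in vw.
- by right.
- by left.
by rewrite hv hw eqxx in vw.
Qed.

Lemma ends_inj a b v w : ends a v w -> ends b v w -> a = b.
Proof. by move=> /andP[_ /eqP h] /andP[_ /eqP k]; apply: val_inj; rewrite h k. Qed.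

(** The chosen direction of [a] is not known, hence the two cases. *)
Lemma initial_half_edgesE a v w : ends a v w ->
  initial_half_edges a = tips v (inl w) \/
  initial_half_edges a = ~: tips v (inl w).
Proof.
move=> /andP[vw /eqP e]; rewrite /initial_half_edges.
have : joins (direction a) (val a) := xchooseP (existsP (valP a)).
case: (direction a) => p q /andP[/= pq /eqP e'].
have -> : [set i | (Defs.half G i != q) &&
    connect [rel x y | adj x y && (y != q)] (Defs.half G i) p]%SET = tips q (inl p).
  by apply/setP => i; rewrite /= !inE avoid_cut inE.
have [[<- <-]|[<- <-]] := set2_eq (adj_neq vw) (etrans (esym e) e').
  by right; rewrite tips_compl.
by left.
Qed.

(** The endpoints of [a] are joined by [a], hence lie on the same side of
    every other edge. *)
Lemma other_edge_side a b v w : ends a v w -> a != b ->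
  exists p q, [/\ ends b p q, v \notin branch p q & w \notin branch p q].
Proof.
move=> avw ab; have vw := ends_adj avw.
have key p q : ends b p q -> v \notin branch p q -> w \notin branch p q.
  move=> bpq; apply: contra => wb; have pq := ends_adj bpq.
  case: (eqVneq v p) => [vp|vp].
    have pw : adj p w by rewrite -vp.
    have wq := branch_unique pw pq (branch_refl pw) wb.
    by rewrite -vp -wq in bpq; rewrite (ends_inj avw bpq) eqxx in ab.
  move: wb; rewrite !inE vp => /andP[wp wq] /=.
  by rewrite (connect_trans _ wq) // connect1 //= vw vp.
have [p [q bpq]] := ends_exist b.
case: (boolP (v \in branch p q)) => vb; last first.
  by exists p, q; split => //; apply: key.
have qp := ends_sym bpq.
have vb' : v \notin branch q p.
  by rewrite (branch_compl (ends_adj bpq)) in_setC vb.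
by exists q, p; split => //; apply: key.
Qed.

End Tree.

(** * Bendings of closed chains of vectors *)

Section Bendings.
Import boot.fintype boot.finset.
Variables (R : realType) (n : nat).
Implicit Types (X : 'I_n -> vec R) (I J : {set 'I_n}) (s t : R).

Definition vsum I X : vec R := \sum_(i in I) X i.
Definition axis I X : vec R := normalize (vsum I X).

(** The diagonal [vsum I X] is the axis of the rotation, hence is fixed: a
    closed chain remains closed. *)
Definition bendv I t X (i : 'I_n) : vec R :=
  if i \in I then turn (axis I X) t (X i) else X i.

Lemma axis_unit I X : vsum I X != 0 -> dot (axis I X) (axis I X) = 1.
Proof. exact: normalize_unit. Qed.

Lemma turn_vsum I X t : vsum I X != 0 -> turn (axis I X) t (vsum I X) = vsum I X.
Proof. by move=> n0; rewrite -(normalizeK n0) -/(axis I X) turn_axis // axis_unit. Qed.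

Lemma vsum_bendv_disjoint I J t X : I \subset ~: J ->
  vsum J (bendv I t X) = vsum J X.
Proof.
move=> IJ; apply: eq_bigr => i iJ; rewrite /bendv ifN //.
by apply: contraL iJ => /(subsetP IJ); rewrite inE.
Qed.

Lemma vsum_bendv_subset I J t X : vsum I X != 0 -> J \subset I ->
  vsum J (bendv I t X) = turn (axis I X) t (vsum J X).
Proof.
move=> n0 /subsetP JI; rewrite /vsum.
rewrite (rotation_sum (turn_is_rotation (axis_unit n0) t)).
by apply: eq_bigr => i /JI iI; rewrite /bendv iI.
Qed.

Lemma vsum_setID I J X : vsum J X = vsum (J :&: I) X + vsum (J :\: I) X.
Proof. exact: big_setID. Qed.

Lemma vsum_bendv_superset I J t X : vsum I X != 0 -> I \subset J ->
  vsum J (bendv I t X) = vsum J X.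
Proof.
move=> n0 IJ; rewrite !(vsum_setID I J) (setIidPr IJ).
rewrite vsum_bendv_subset // turn_vsum // vsum_bendv_disjoint //.
by apply/subsetP => i iI; rewrite !inE iI.
Qed.

Definition closed_up (ell : 'I_n -> R) X : Prop :=
  (forall i, vnorm (X i) = ell i) /\ \sum_i X i = 0.

Lemma sum_setT X : \sum_i X i = vsum [set: 'I_n] X.
Proof. by apply: eq_bigl => i; rewrite inE. Qed.

Lemma vsumC I X : \sum_i X i = 0 -> vsum (~: I) X = - vsum I X.
Proof.
rewrite sum_setT (vsum_setID I) setTI setTD => /eqP.
by rewrite addrC addr_eq0 => /eqP.
Qed.

Lemma bendv_closed_up ell I t X : vsum I X != 0 ->
  closed_up ell X -> closed_up ell (bendv I t X).
Proof.
move=> n0 [hX sX]; split=> [i|].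
  rewrite /bendv; case: ifP => // _.
  by rewrite (rotation_vnorm (turn_is_rotation (axis_unit n0) t)).
by rewrite sum_setT vsum_bendv_superset ?subsetT // -sum_setT.
Qed.

Lemma bendv0 I X : bendv I 0 X =1 X.
Proof. by move=> i; rewrite /bendv turn0 if_same. Qed.

Lemma eq_vsum I X X' : X =1 X' -> vsum I X = vsum I X'.
Proof. by move=> e; apply: eq_bigr => i _; exact: e. Qed.

Lemma eq_bendv I t X X' : X =1 X' -> bendv I t X =1 bendv I t X'.
Proof. by move=> e i; rewrite /bendv /axis (eq_vsum I e) e. Qed.

Lemma axis_bendv_superset I J t X : vsum I X != 0 -> I \subset J ->
  axis J (bendv I t X) = axis J X.
Proof. by move=> n0 IJ; rewrite /axis vsum_bendv_superset. Qed.

Lemma bendv_add I s t X : vsum I X != 0 ->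
  bendv I s (bendv I t X) =1 bendv I (s + t) X.
Proof.
move=> n0 i; rewrite {1}/bendv axis_bendv_superset // /bendv.
by case: (i \in I) => //; rewrite turn_add // axis_unit.
Qed.

Lemma bendv_periodic I t X : bendv I (t + 2 * pi) X =1 bendv I t X.
Proof. by move=> i; rewrite /bendv turn_periodic. Qed.

Lemma bendv_rotation T I t X : is_rotation T ->
  bendv I t (T \o X) =1 T \o bendv I t X.
Proof.
move=> hT i; rewrite /bendv /=; case: ifP => // _.
rewrite (rotation_turn hT) /axis (rotation_normalize hT).
by rewrite /vsum (rotation_sum hT).
Qed.

(** The two sides turn about the same axis in opposite directions, so that
    their bendings differ by a global rotation. *)
Lemma bendv_compl I t X : vsum I X != 0 -> \sum_i X i = 0 ->
  bendv I t X =1 turn (axis I X) t \o bendv (~: I) t X.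
Proof.
move=> n0 X0 i; rewrite /bendv /= in_setC; case: ifP => //= iI.
rewrite /axis (vsumC I X0) normalizeN turnNaxis turn_add ?normalize_unit //.
by rewrite subrr turn0.
Qed.

Lemma bendv_comm_disjoint I J s t X : I \subset ~: J ->
  bendv I s (bendv J t X) =1 bendv J t (bendv I s X).
Proof.
move=> IJ i; have JI : J \subset ~: I by rewrite -setCS setCK.
have eI : axis I (bendv J t X) = axis I X by rewrite /axis vsum_bendv_disjoint.
have eJ : axis J (bendv I s X) = axis J X by rewrite /axis vsum_bendv_disjoint.
rewrite {1}/bendv eI [RHS]/bendv eJ /bendv.
case: (boolP (i \in I)) => iI; case: (boolP (i \in J)) => iJ //.
by have := subsetP IJ _ iI; rewrite inE iJ.
Qed.

(** The bending of [J] carries the axis of [I] along, which conjugates the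
    rotation of [I]. *)
Lemma bendv_comm_subset I J s t X : vsum I X != 0 -> vsum J X != 0 ->
  I \subset J -> bendv I s (bendv J t X) =1 bendv J t (bendv I s X).
Proof.
move=> nI nJ IJ i; have hR := turn_is_rotation (axis_unit nJ) t.
have eJ : axis J (bendv I s X) = axis J X by rewrite axis_bendv_superset.
have eI : axis I (bendv J t X) = turn (axis J X) t (axis I X).
  by rewrite /axis vsum_bendv_subset // (rotation_normalize hR).
rewrite {1}/bendv eI [RHS]/bendv eJ /bendv.
case: (boolP (i \in I)) => iI; case: (boolP (i \in J)) => iJ //.
  by rewrite -(rotation_turn hR).
by rewrite (subsetP IJ) in iJ.
Qed.

End Bendings.

(** * Polygons and their classes *)

Section Polygons.
Variables (R : realType) (n : nat) (ell : 'I_n -> R).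
Local Notation polygon := (closed_polygon ell).
Implicit Types (x y : polygon) (X : 'I_n -> vec R).

Definition pv x i : vec R := vec_of (val x i).

(** The polygon [x] is a default value for the chains that do not close up. *)
Definition mk x X : polygon := insubd x [ffun i => mx_of (X i)].

Lemma mx_pv x i : mx_of (pv x i) = val x i.
Proof. by have /asboolP[/(_ i) [hs _] _] := valP x; exact: vec_ofK. Qed.

Lemma pv_closed_up x : closed_up ell (pv x).
Proof.
have /asboolP[hx sx] := valP x; split=> [i|].
  by rewrite -snorm_mx_of mx_pv; have [] := hx i.
by rewrite /pv -vec_of_sum sx vec_of0.
Qed.

Lemma pv_sum x : \sum_i pv x i = 0. Proof. by have [] := pv_closed_up x. Qed.

Lemma pv_inj x y : pv x =1 pv y -> x = y.
Proof.
by move=> e; apply/val_inj/ffunP => i; rewrite -!mx_pv e.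
Qed.

Lemma val_mk x X i : closed_up ell X -> val (mk x X) i = mx_of (X i).
Proof.
move=> [hX sX]; rewrite /mk val_insubd; case: asboolP => [_|[]]; first by rewrite ffunE.
split=> [j|].
  by rewrite ffunE; split; [exact: su2_mx_of|rewrite snorm_mx_of].
by under eq_bigr do rewrite ffunE; rewrite -mx_of_sum sX mx_of0.
Qed.

Lemma pv_mk x X : closed_up ell X -> pv (mk x X) =1 X.
Proof. by move=> hX i; rewrite /pv val_mk // mx_ofK. Qed.

Lemma class_eqP x y : polygon_class x = polygon_class y <->
  exists2 g, SU2 g & forall i, pv y i = ad g (pv x i).
Proof.
have -> : (polygon_class x = polygon_class y) <-> congruent x y.
  split=> [/eqP|h]; first by rewrite /polygon_class eqmodE.
  by apply/eqP; rewrite /polygon_class eqmodE.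
split=> [/asboolP|] [g gS e].
  exists g => // i; apply: (@mx_of_inj R).
  by rewrite mx_of_ad // !mx_pv.
by apply/asboolP; exists g => // i; rewrite -!mx_pv e mx_of_ad.
Qed.

Lemma class_repr (p : polygon_space ell) : polygon_class (repr p) = p.
Proof. exact: reprK. Qed.

Lemma class_eq_pv x y : pv x =1 pv y -> polygon_class x = polygon_class y.
Proof. by move=> /pv_inj ->. Qed.

Lemma class_eq_rotation x y T : is_rotation T ->
  (forall i, pv y i = T (pv x i)) -> polygon_class x = polygon_class y.
Proof.
move=> /rotation_is_ad[g gS hT] e; apply/class_eqP.
by exists g => // i; rewrite e hT.
Qed.

Lemma class_eq_is_rotation x y : polygon_class x = polygon_class y ->
  exists2 T, is_rotation T & forall i, pv y i = T (pv x i).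
Proof.
by move=> /class_eqP[g gS e]; exists (ad g) => //; exact: ad_is_rotation.
Qed.

(** A polygon all of whose edges are parallel to the non-zero edge [i0] lies
    on a line. *)
Lemma singularP x (i0 : 'I_n) : 0 < ell i0 ->
  ~ singular_set (polygon_class x) <->
  exists j k, cross (pv x j) (pv x k) != 0.
Proof.
move=> ell0; split=> [ns|[j [k n0]] [y [u [us u0 yu]]]].
  apply: contrapT => h; apply: ns; exists x => //; exists (val x i0).
  have [hx _] := pv_closed_up x.
  have x0 : pv x i0 != 0 by rewrite -vnorm_gt0 hx.
  split; first by rewrite -mx_pv; exact: su2_mx_of.
    by apply: contraNneq x0 => e; rewrite /pv e vec_of0.
  move=> i; exists (dot (pv x i0) (pv x i) / dot (pv x i0) (pv x i0)).
  rewrite -!mx_pv -mx_ofZ -cross_eq0_collinear //.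
  by apply: contrapT => /eqP n0; apply: h; exists i0, i.
move=> /class_eq_is_rotation[T hT e].
have ex i : exists k, pv x i = k *: T (vec_of u).
  have [a ya] := yu i; exists a.
  by rewrite e -(rotationZ hT) -vec_ofZ -ya.
move: n0; have [a ->] := ex j; have [b ->] := ex k.
by rewrite crossZl crossZr crossvv !scaler0 eqxx.
Qed.

End Polygons.

(** * The symplectic form of a coadjoint orbit *)

Section KirillovForm.
Variables (R : realType) (n : nat) (ell : 'I_n -> R).
Hypothesis ell_gt0 : forall i, 0 < ell i.

Lemma tangent_cross (v w : vec R) : v != 0 -> dot v w = 0 ->
  exists a, w = - 2 *: cross a v.
Proof.
move=> v0 vw; have vv0 : dot v v != 0 by rewrite dot_eq0.
exists ((2 * dot v v)^-1 *: cross w v).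
transitivity ((2 * dot v v)^-1 *: (2 *: cross v (cross w v))); last by vec_ring.
rewrite double_cross vw scale0r subr0 !scalerA -mulrA mulVf ?scale1r //.
by rewrite mulf_neq0 // pnatr_eq0.
Qed.

(** If [w] is the bracket of [eta] and [v], then [<v, [a, eta]>] and [<a, w>]
    are the same triple product. It depends on [a] and [eta] only through
    their brackets with [v], hence not on the choice made by [generator]. *)
Lemma kks_mx_of (v a w : vec R) : v != 0 -> dot v w = 0 ->
  kks (mx_of v) (mx_of (- 2 *: cross a v)) (mx_of w) = dot a w.
Proof.
move=> v0 vw.
have two0 : - 2 != 0 :> R by rewrite oppr_eq0 pnatr_eq0.
have gen b : exists2 b', generator (mx_of v) (mx_of (- 2 *: cross b v)) = mx_of b'
    & cross b' v = cross b v.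
  rewrite /generator; case: xgetP => [y _ [ys]|/(_ (mx_of b))]; last first.
    by case; split; [exact: su2_mx_of|exact: bracket_mx_of].
  rewrite -(vec_ofK ys) bracket_mx_of => /mx_of_inj /(scalerI two0) e.
  by exists (vec_of y); rewrite ?vec_ofK.
have [b wb] := tangent_cross v0 vw.
rewrite {1}wb /kks; have [a' -> ea] := gen a; have [b' -> eb] := gen b.
rewrite bracket_mx_of sdot_mx_of wb -eb !dotZr.
congr (_ * _); rewrite 2!dot_cross_rot [RHS]dot_cross_rot.
by rewrite (crossC v) ea -crossC.
Qed.


End KirillovForm.

(** * Velocities in the polygon space *)

Section RealDerivatives.
Variable R : realType.
Implicit Types (f : R -> R) (s t a b : R).

Lemma is_derive_cvg f t a : is_derive t 1 f a -> f s @[s --> t] --> f t.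
Proof.
by move=> [h _]; apply: differentiable_continuous; apply/derivable1_diffP.
Qed.

Lemma is_derive_near_gt0 f t a : is_derive t 1 f a -> 0 < f t ->
  \forall s \near t, 0 < f s.
Proof. by move=> /is_derive_cvg h ft; apply: cvgr_gt h _ ft. Qed.

(** Mean value theorem. *)
Lemma constant_of_derive0 f a b :
  (forall s, a < s < b -> is_derive s 1 f 0) ->
  forall s t, a < s < b -> a < t < b -> f s = f t.
Proof.
move=> h s t; wlog st : s t / s <= t.
  by move=> hw hs ht; case: (leP s t) => [/hw|/ltW /hw]; [exact|move=> ->].
move=> /andP[as_ sb] /andP[at_ tb].
have inI r : s <= r <= t -> a < r < b.
  move=> /andP[sr rt]; rewrite (lt_le_trans as_ sr).
  exact: le_lt_trans rt tb.
have [|| c _] := @MVT_segment R f (fun=> 0) s t st.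
- move=> r; rewrite in_itv /= => /andP[/ltW sr /ltW rt].
  by apply: h; apply: inI; rewrite sr.
- apply: derivable_within_continuous => r; rewrite in_itv /= => hr.
  by have [] := h _ (inI _ hr).
by rewrite mul0r => /eqP; rewrite subr_eq0 => /eqP.
Qed.

Lemma is_derive_near_eq (f g : R -> R) t a : (\forall s \near t, f s = g s) ->
  is_derive t 1 f a -> is_derive t 1 g a.
Proof. exact: near_eq_is_derive. Qed.

End RealDerivatives.

Section Velocities.
Variables (R : realType) (n : nat) (ell : 'I_n -> R).
Local Notation polygon := (closed_polygon ell).
Implicit Types (x y : polygon) (t : R) (gamma : R -> polygon_space ell).

Lemma is_derive_mx_of (c : R -> vec R) t u j k : vderiv c t u ->
  is_derive t 1 (fun s => complex.Re (mx_of (c s) j k))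
    (complex.Re (mx_of u j k)) /\
  is_derive t 1 (fun s => complex.Im (mx_of (c s) j k))
    (complex.Im (mx_of u j k)).
Proof.
move=> [h1 h2 h3]; rewrite mxE; under eq_fun do rewrite mxE.
under [X in _ /\ is_derive _ _ X _]eq_fun do rewrite mxE.
have h0 := is_derive_const 0 t.
by case: (j == 0); case: (k == 0) => /=; split => //; exact: is_derive_opp.
Qed.

Lemma velocity_intro x (c : R -> 'I_n -> vec R) t (u : 'I_n -> vec R) :
  (\forall s \near t, closed_up ell (c s)) ->
  (forall i, vderiv (c^~ i) t (u i)) ->
  has_velocity (fun s => polygon_class (mk x (c s))) t (mk x (c t))
    (fun i => mx_of (u i)).
Proof.
move=> hc hu; exists (fun s => mk x (c s)); split => //.
  by apply: filterE.
move=> i j k; have [h1 h2] := is_derive_mx_of j k (hu i).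
by split; [move: h1|move: h2]; apply: is_derive_near_eq;
  apply: filterS hc => s hs; rewrite val_mk.
Qed.

(** The entries of the matrices of [su(2)] satisfy linear relations, which
    pass to velocities. *)
Lemma velocity_elim gamma t x u : has_velocity gamma t x u ->
  exists c : R -> polygon, [/\ c t = x,
    \forall s \near t, polygon_class (c s) = gamma s,
    forall i, vderiv (fun s => pv (c s) i) t (vec_of (u i)) &
    forall i, mx_of (vec_of (u i)) = u i].
Proof.
move=> [c [ct cg cu]]; exists c; split=> // i.
  split; [exact: (cu i 0 0).2|exact: (cu i 0 1).2|exact: (cu i 0 1).1].
have su s : su2 (val (c s) i) by rewrite -mx_pv; exact: su2_mx_of.
have eqv (f g : R -> R) (a b : R) : f =1 g ->
    is_derive t 1 f a -> is_derive t 1 g b -> a = b.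
  by move=> /funext <-; exact: is_derive_uniq.
have h0 := is_derive_const 0 t.
apply: su2_of_entries.
- by apply: (eqv _ _ _ _ _ (cu i 0 0).1 h0) => s; have [] := su2P (su s).
- by apply: (eqv _ _ _ _ _ (cu i 1 1).1 h0) => s; have [] := su2P (su s).
- apply: (eqv _ _ _ _ _ (cu i 1 1).2 (is_derive_opp (cu i 0 0).2)) => s.
  by have [] := su2P (su s).
- apply: (eqv _ _ _ _ _ (cu i 1 0).1 (is_derive_opp (cu i 0 1).1)) => s.
  by have [] := su2P (su s).
apply: (eqv _ _ _ _ _ (cu i 1 0).2 (cu i 0 1).2) => s.
by have [] := su2P (su s).
Qed.

(** The lengths of the edges and their sum are constant along any curve. *)
Lemma velocity_tangent gamma t x u : has_velocity gamma t x u ->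
  (forall i, dot (pv x i) (vec_of (u i)) = 0) /\ \sum_i vec_of (u i) = 0.
Proof.
move=> /velocity_elim[c [ct _ cu _]]; split=> [i|].
  have h := is_derive_dot (cu i) (cu i).
  have e : (fun s => dot (pv (c s) i) (pv (c s) i)) = fun=> ell i ^+ 2.
    by apply/funext => s; rewrite -vnorm_sqr; have [-> _] := pv_closed_up (c s).
  rewrite e in h; have := is_derive_uniq h (is_derive_const _ t).
  by rewrite ct dotC -mulr2n => /eqP; rewrite mulrn_eq0 => /eqP.
have [h1 h2 h3] := vderiv_sum (index_enum 'I_n) xpredT cu.
have e : (fun s => \sum_i pv (c s) i) = fun=> 0.
  by apply/funext => s; exact: pv_sum.
have [k1 k2 k3] := vderiv_cst (0 : vec R) t.
have {}e s : \sum_i pv (c s) i = 0 by exact: pv_sum.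
apply: vec_ext.
- by move: h1; under eq_fun do rewrite e; move=> /is_derive_uniq; apply.
- by move: h2; under eq_fun do rewrite e; move=> /is_derive_uniq; apply.
by move: h3; under eq_fun do rewrite e; move=> /is_derive_uniq; apply.
Qed.

End Velocities.

Section ReducedForm.
Variables (R : realType) (n : nat) (ell : 'I_n -> R).
Hypothesis ell_gt0 : forall i, 0 < ell i.
Local Notation polygon := (closed_polygon ell).
Implicit Types (x y : polygon).

Lemma pv_neq0 x i : pv x i != 0.
Proof. by rewrite -vnorm_gt0; have [-> _] := pv_closed_up x. Qed.

Lemma reduced_formE x gamma w (a : 'I_n -> vec R) :
  has_velocity gamma 0 x w ->
  reduced_form x (fun i => mx_of (- 2 *: cross (a i) (pv x i))) w =
  \sum_i dot (a i) (vec_of (w i)).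
Proof.
move=> hw; have [tw _] := velocity_tangent hw.
have [c [_ _ _ ew]] := velocity_elim hw.
apply: eq_bigr => i _; rewrite -mx_pv -{1}(ew i).
by rewrite kks_mx_of // pv_neq0.
Qed.

End ReducedForm.

(** * Non-degeneracy of the reduced form *)

Section Triangle.
Variable R : realType.

(** A non-flat triangle with sides [x], [y] and [sig 0] can be deformed so as
    to close up a prescribed moving side [sig], the two other lengths being
    fixed. The moving vertex is sought in the plane of [sig s] and of its
    cross product with the initial normal; its two coordinates are given by
    the lengths, and the square root involved is differentiable because the
    triangle is not flat. *)
Lemma triangle_deformation (x y dsig : vec R) (sig : R -> vec R) :
  cross x y != 0 -> sig 0 = x + y -> vderiv sig 0 dsig ->
  exists (p : R -> vec R) (dp : vec R), [/\ vderiv p 0 dp, p 0 = x,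
    \forall s \near (0 : R), dot (p s) (p s) = dot x x &
    \forall s \near (0 : R), dot (sig s - p s) (sig s - p s) = dot y y].
Proof.
move=> n0 sig0 hsig; set m := cross x y.
(* The lengths of the two other sides prescribe the coordinate [al] of [p]
    along [sig] and the square [q] of its coordinate along [cross m sig],
    which is negative at time [0]. *)
pose A s := dot (sig s) (sig s).
pose B s := dot (cross m (sig s)) (cross m (sig s)).
pose al s := (A s + dot x x - dot y y) * (2 * A s)^-1.
pose q s := (dot x x - al s * (al s * A s)) * (B s)^-1.
pose p s := al s *: sig s - Num.sqrt (q s) *: cross m (sig s).
have mm0 : dot m m != 0 by rewrite dot_eq0.
have A0E : A 0 = dot x x + 2 * dot x y + dot y y.
  by rewrite /A sig0; vec_ring.
have sig0n : sig 0 != 0.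
  apply: contraNneq n0 => e; rewrite /m.
  have -> : y = - x by apply/eqP; rewrite -addr_eq0 addrC -sig0 e.
  by rewrite crossNr crossvv oppr0.
have A0 : A 0 != 0 by rewrite /A dot_eq0.
have B0E : B 0 = dot m m * A 0.
  by rewrite /B /A sig0 /m; vec_ring.
have B0 : B 0 != 0 by rewrite B0E mulf_neq0.
have al0E : al 0 = (dot x x + dot x y) / A 0.
  by rewrite /al A0E; field; rewrite -A0E A0.
have q0E : q 0 = (A 0)^-1 ^+ 2.
  have h : dot x x * A 0 - (dot x x + dot x y) ^+ 2 = dot m m.
    by rewrite A0E /m; vec_ring.
  rewrite /q al0E B0E.
  transitivity ((dot x x * A 0 - (dot x x + dot x y) ^+ 2) / (dot m m * A 0 ^+ 2)).
    by field; rewrite A0 mm0.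
  by rewrite h; field; rewrite A0 mm0.
have q0 : 0 < q 0 by rewrite q0E exprn_gt0 // invr_gt0 /A dot_gt0.
have dA := is_derive_dot hsig hsig.
have dm := vderiv_cross (vderiv_cst m 0) hsig.
have dB := is_derive_dot dm dm.
have d2A := is_derive_inv (f := fun s => 2 * A s)
  (mulf_neq0 (lt0r_neq0 (ltr0n R 2)) A0)
  (is_derive_mul (is_derive_const 2 0) dA).
have dal := is_derive_mul (is_derive_add (is_derive_add dA
  (is_derive_const (dot x x) 0)) (is_derive_const (- dot y y) 0)) d2A.
have dq := is_derive_mul (is_derive_add (is_derive_const (dot x x) 0)
  (is_derive_opp (is_derive_mul dal (is_derive_mul dal dA))))
  (is_derive_inv (f := B) B0 dB).
have dp := vderivB (vderivZ dal hsig)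
  (vderivZ (is_derive_sqrt (f := q) q0 dq) dm).
have nA : \forall s \near (0 : R), 0 < A s.
  by apply: is_derive_near_gt0 dA _; rewrite /A dot_gt0.
have nB : \forall s \near (0 : R), 0 < B s.
  by apply: is_derive_near_gt0 dB _; rewrite dot_gt0 -dot_eq0.
have nq : \forall s \near (0 : R), 0 < q s by apply: is_derive_near_gt0 dq q0.
have pp s : 0 < B s -> 0 < q s -> dot (p s) (p s) = dot x x.
  move=> Bs qs; have hq : Num.sqrt (q s) ^+ 2 * B s = dot x x - al s * (al s * A s).
    by rewrite sqr_sqrtr ?ltW // /q -mulrA mulVf ?mulr1 // gt_eqF.
  have -> : dot (p s) (p s) = al s * (al s * A s) + Num.sqrt (q s) ^+ 2 * B s.
    by rewrite /p /A /B; vec_ring.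
  by rewrite hq addrC subrK.
exists p; eexists; split; first exact: dp.
- rewrite /p q0E sqrtr_sqr ger0_norm ?invr_ge0 ?dot_ge0 // al0E sig0.
  apply: (scalerI A0); rewrite scalerBr !scalerA mulfV // scale1r.
  rewrite [_ * (_ / _)]mulrC divfK // A0E /m.
  by vec_ring.
- by near=> s; apply: pp; near: s.
near=> s; have ps : dot (p s) (p s) = dot x x by apply: pp; near: s.
have As : A s != 0 by rewrite gt_eqF //; near: s.
have sp : dot (sig s) (p s) = al s * A s.
  by rewrite /p /A; vec_ring.
have -> : dot (sig s - p s) (sig s - p s) = A s - 2 * dot (sig s) (p s) + dot (p s) (p s).
  by rewrite /A; vec_ring.
by rewrite sp ps /al; field.
Unshelve. all: by end_near. Qed.

End Triangle.

(** Sealed: a bent polygon is known through its edges only ([pv_bend]). *)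
HB.lock Definition bend (R : realType) (n : nat) (ell : 'I_n -> R)
    (I : {set 'I_n}) (t : R) (x : closed_polygon ell) : closed_polygon ell :=
  mk x (bendv I t (pv x)).

Section Annihilator.
Variables (R : realType) (n : nat) (ell : 'I_n -> R).
Hypothesis ell_gt0 : forall i, 0 < ell i.
Local Notation polygon := (closed_polygon ell).
Implicit Types (x y : polygon).

Definition bending_field (I : {set 'I_n}) (X : 'I_n -> vec R) (i : 'I_n) : vec R :=
  if i \in I then cross (axis I X) (X i) else 0.

Lemma pv_bend I t x : vsum I (pv x) != 0 -> pv (bend I t x) =1 bendv I t (pv x).
Proof. by move=> n0; rewrite bend.unlock; apply: pv_mk; apply: bendv_closed_up (pv_closed_up x). Qed.

Lemma bend_velocity I x t : vsum I (pv x) != 0 ->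
  has_velocity (fun s => polygon_class (bend I s x)) t (bend I t x)
    (fun i => mx_of (bending_field I (pv (bend I t x)) i)).
Proof.
move=> n0.
have bE s : bend I s x = mk x (bendv I s (pv x)) by rewrite bend.unlock.
rewrite (_ : (fun s => polygon_class (bend I s x)) =
  fun s => polygon_class (mk x (bendv I s (pv x)))); last first.
  by apply/funext => s; rewrite bE.
rewrite [X in has_velocity _ _ X]bE.
apply: (@velocity_intro _ _ _ x (fun s => bendv I s (pv x))).
  by apply: filterE => s; apply: bendv_closed_up (pv_closed_up x).
move=> i; rewrite /bending_field /axis (eq_vsum _ (pv_bend _ n0)).
rewrite -/(axis _ _) axis_bendv_superset // pv_bend // /bendv.
case: (i \in I); last exact: vderiv_cst.
by apply: vderiv_turn; rewrite axis_unit.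
Qed.

Lemma bend0 I x : vsum I (pv x) != 0 -> bend I 0 x = x.
Proof. by move=> n0; apply: pv_inj => i; rewrite pv_bend // bendv0. Qed.

(** The edges [j] and [k] compensate for the motion of [i], by
    [triangle_deformation]. Their velocities are left unspecified: in
    [annihilator], [a j - b] and [a k - b] are parallel to these edges, hence
    orthogonal to their velocities. *)
Lemma edge_velocity x j k i e : cross (pv x j) (pv x k) != 0 ->
  i != j -> i != k -> dot e e = 1 ->
  exists gamma w, [/\ has_velocity gamma 0 x w,
    vec_of (w i) = cross e (pv x i) &
    forall l, l != i -> l != j -> l != k -> vec_of (w l) = 0].
Proof.
move=> n0 ij ik e1.
have jk : j != k by apply: contraNneq n0 => ->; rewrite crossvv.
pose a s := turn e s (pv x i).
pose sig s := pv x i + pv x j + pv x k - a s.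
have da := vderiv_turn (pv x i) 0 e1.
have dsig := vderivB (vderiv_cst (pv x i + pv x j + pv x k) 0) da.
have a0 : a 0 = pv x i by rewrite /a turn0.
have sig0 : sig 0 = pv x j + pv x k.
  by rewrite /sig a0; vec_ring.
have [p [dp [hp p0 pj pk]]] := triangle_deformation n0 sig0 dsig.
pose c s l := if l == i then a s else if l == j then p s
  else if l == k then sig s - p s else pv x l.
pose u l := if l == i then cross e (pv x i) else if l == j then dp
  else if l == k then 0 - cross e (turn e 0 (pv x i)) - dp else 0.
have c0 : c 0 =1 pv x.
  move=> l; rewrite /c; case: eqP => [->//|_]; case: eqP => [->//|_].
  by case: eqP => [->|//]; rewrite sig0 p0 addrAC subrr add0r.
have [hx sx] := pv_closed_up x.
have hc : \forall s \near (0 : R), closed_up ell (c s).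
  near=> s; split=> [l|].
    rewrite /c; case: eqP => [->|_].
      by rewrite (rotation_vnorm (turn_is_rotation e1 s)).
    case: eqP => [->|_]; first by rewrite -hx /vnorm; congr Num.sqrt; near: s.
    by case: eqP => [->|_] //; rewrite -hx /vnorm; congr Num.sqrt; near: s.
  rewrite -[RHS]sx (bigD1 i) //= (bigD1 j) ?(eq_sym j) //=.
  rewrite (bigD1 k) ?(eq_sym k) ?ik ?jk //=.
  rewrite [RHS](bigD1 i) //= [in RHS](bigD1 j) ?(eq_sym j) //=.
  rewrite [in RHS](bigD1 k) ?(eq_sym k) ?ik ?jk //=.
  rewrite /c !eqxx (eq_sym j) (negbTE ij) !(eq_sym k) (negbTE ik) (negbTE jk).
  rewrite !addrA; congr (_ + _).
    by rewrite /sig; vec_ring.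
  by apply: eq_bigr => l /andP[/andP[/negbTE-> /negbTE->] /negbTE->].
have hu l : vderiv (c^~ l) 0 (u l).
  rewrite /c /u; case: (l == i); first by apply: vderiv_eqv da _; rewrite turn0.
  case: (l == j) => //; case: (l == k); last exact: vderiv_cst.
  exact: vderivB dsig hp.
have hv := velocity_intro x hc hu.
have ex : mk x (c 0) = x.
  by apply: pv_inj => l; rewrite pv_mk ?c0 //; apply: (nbhs_singleton hc).
rewrite ex in hv; exists (fun s => polygon_class (mk x (c s))), (fun l => mx_of (u l)).
split=> // [|l /negbTE li /negbTE lj /negbTE lk]; rewrite mx_ofK /u ?eqxx //.
by rewrite li lj lk.
Unshelve. all: by end_near. Qed.

(** The reduced form is non-degenerate: a family of infinitesimal rotations of
    the edges that pairs to zero with every velocity is a global one. Bending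
    [j] and [k] shows that a single [b] is suitable for these two edges; once
    [b] is subtracted, moving another edge [i] tests [a i] alone. *)
Lemma annihilator x (a : 'I_n -> vec R) j k : cross (pv x j) (pv x k) != 0 ->
  (forall gamma w, has_velocity gamma 0 x w ->
     \sum_i dot (a i) (vec_of (w i)) = 0) ->
  exists b, forall i, cross (a i) (pv x i) = cross b (pv x i).
Proof.
move=> n0 ha; set m := cross (pv x j) (pv x k).
have jk : j != k by apply: contraNneq n0 => ->; rewrite crossvv.
have mm0 : dot m m != 0 by rewrite dot_eq0.
(* Bending [j] and [k] about [x_j + x_k] tests [a k - a j] along the normal
    [m]. *)
have dm : dot (a k - a j) m = 0.
  pose I := [set j; k]%SET.
  have sI : vsum I (pv x) = pv x j + pv x k.
    by rewrite /vsum big_setU1 ?inE ?jk //= big_set1.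
  have sI0 : vsum I (pv x) != 0.
    rewrite sI; apply: contraNneq n0 => e.
    have -> : pv x k = - pv x j by apply/eqP; rewrite -addr_eq0 addrC e.
    by rewrite crossNr crossvv oppr0.
  have := bend_velocity 0 sI0; rewrite bend0 // => /ha.
  rewrite (bigD1 j) //= (bigD1 k) ?(eq_sym k) //= big1 => [|l /andP[lj lk]]; last first.
    by rewrite mx_ofK /bending_field !inE (negbTE lj) (negbTE lk) dot0r.
  rewrite !mx_ofK /bending_field !inE !eqxx orbT /= addr0 /axis /normalize sI.
  rewrite !crossZl !dotZr -mulrDr => /eqP; rewrite mulf_eq0 invr_eq0.
  rewrite vnorm_eq0 -sI (negbTE sI0) /= => /eqP <-; rewrite sI /m.
  by vec_ring.
pose d := a k - a j.
(* The coordinates of [d] in the basis [x_j], [x_k] of the plane orthogonal to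
    [m], which contains [d] by [dm]. *)
pose al := (dot d (pv x j) * dot (pv x k) (pv x k)
  - dot d (pv x k) * dot (pv x j) (pv x k)) / dot m m.
pose be := (dot d (pv x k) * dot (pv x j) (pv x j)
  - dot d (pv x j) * dot (pv x j) (pv x k)) / dot m m.
have dE : d = al *: pv x j + be *: pv x k.
  apply: (scalerI mm0); rewrite /m frame_expand -/m dm scale0r add0r.
  rewrite scalerDr !scalerA /al /be ![dot m m * _]mulrC !divfK // /m.
  by vec_ring.
pose b := a j + al *: pv x j; exists b.
have hj : cross (a j) (pv x j) = cross b (pv x j).
  by rewrite /b crossDl crossZl crossvv scaler0 addr0.
have hk : cross (a k) (pv x k) = cross b (pv x k).
  have -> : a k = a j + d by rewrite /d addrC subrK.
  by rewrite dE /b !crossDl !crossZl crossvv scaler0 addr0.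
move=> i; case: (eqVneq i j) => [->|ij] //; case: (eqVneq i k) => [->|ik] //.
have hb gamma w : has_velocity gamma 0 x w ->
    \sum_i dot (a i - b) (vec_of (w i)) = 0.
  move=> hw; have [_ sw] := velocity_tangent hw.
  under eq_bigr do rewrite dotDl; rewrite big_split /= (ha _ _ hw).
  by rewrite -dot_sumr sw dot0r addr0.
apply/eqP; rewrite -subr_eq0 -crossNl -crossDl crossC oppr_eq0; apply/eqP.
apply: orthogonal_to_unit => e e1.
have [gamma [w [hw wi wl]]] := edge_velocity n0 ij ik e1.
have [tw _] := velocity_tangent hw.
have vanish l : cross (a l) (pv x l) = cross b (pv x l) ->
    dot (a l - b) (vec_of (w l)) = 0.
  move=> h; have x0 : pv x l != 0 by exact: pv_neq0.
  have /(cross_eq0_collinear x0) -> : cross (pv x l) (a l - b) = 0.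
    by rewrite crossC crossDl crossNl h subrr oppr0.
  by rewrite dotZl tw mulr0.
have := hb _ _ hw; rewrite (bigD1 i) //= (bigD1 j) ?(eq_sym j) //=.
rewrite (bigD1 k) ?(eq_sym k) ?ik ?jk //= (vanish j hj) (vanish k hk).
rewrite big1 => [|l /andP[/andP[li lj] lk]]; last by rewrite wl // dot0r.
by rewrite !addr0 wi => <-; vec_ring.
Qed.

End Annihilator.

(** * The Hamiltonian flow of the length of a diagonal *)

Section BendingFlow.
Variables (R : realType) (n : nat) (ell : 'I_n -> R).
Hypothesis ell_gt0 : forall i, 0 < ell i.
Local Notation polygon := (closed_polygon ell).
Implicit Types (x y : polygon) (s t : R) (gamma : R -> polygon_space ell).

Variables (I : {set 'I_n}) (f : polygon_space ell -> R).
Hypothesis fE : forall x, f (polygon_class x) = 2^-1 * vnorm (vsum I (pv x)).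

Lemma vderiv_vsum (c : R -> polygon) t (u : 'I_n -> vec R) :
  (forall i, vderiv (fun s => pv (c s) i) t (u i)) ->
  vderiv (fun s => vsum I (pv (c s))) t (vsum I u).
Proof. by move=> h; apply: vderiv_sum. Qed.

Lemma is_derive_diagonal gamma x w : vsum I (pv x) != 0 ->
  has_velocity gamma 0 x w -> is_derive (0 : R) 1 (f \o gamma)
    (2^-1 * dot (axis I (pv x)) (vsum I (fun i => vec_of (w i)))).
Proof.
move=> n0 /velocity_elim[c [c0 cg cw _]].
have hv := vderiv_vsum cw; rewrite -c0 in n0 *.
have h := is_derive_mul (is_derive_const 2^-1 0) (is_derive_vnorm n0 hv).
rewrite mulr0 addr0 in h; apply: is_derive_near_eq h.
by apply: filterS cg => s /= <-; rewrite fE.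
Qed.

Lemma bending_fieldE X i : bending_field I X i =
  - 2 *: cross (if i \in I then (- 2^-1 : R) *: axis I X else 0) (X i).
Proof.
rewrite /bending_field; case: ifP => _; last first.
  by rewrite crossC cross0r oppr0 scaler0.
by rewrite crossZl scalerA mulrNN mulfV ?scale1r // pnatr_eq0.
Qed.

(** The bending field comes from the infinitesimal rotations [- axis / 2] of
    the edges in [I]; its pairing with a velocity is minus half the derivative
    of the length of the diagonal. *)
Lemma bending_field_hamiltonian x : vsum I (pv x) != 0 ->
  hamiltonian_vector f x (fun i => mx_of (bending_field I (pv x) i)).
Proof.
move=> n0; split.
  by exists (fun s => polygon_class (bend I s x)); have := bend_velocity 0 n0;
    rewrite bend0.
move=> gamma w hw; exists (2^-1 * dot (axis I (pv x)) (vsum I (fun i => vec_of (w i)))).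
  exact: is_derive_diagonal hw.
rewrite [reduced_form _ _ _](_ : _ = reduced_form x (fun i => mx_of (- 2 *: cross
  (if i \in I then (- 2^-1 : R) *: axis I (pv x) else 0) (pv x i))) w); last first.
  by apply: eq_bigr => i _; rewrite bending_fieldE.
rewrite (reduced_formE ell_gt0 _ hw) dot_sumr mulr_sumr.
rewrite [X in _ + X](bigID [pred i | i \in I]) /= [X in _ + (_ + X)]big1; last first.
  by move=> i /negbTE->; rewrite dot0l.
rewrite addr0 -big_split /= big1 // => i iI.
by rewrite iI dotZl; ring.
Qed.

(** The difference of two Hamiltonian vectors pairs to zero with every
    velocity, to which [annihilator] applies. *)
Lemma hamiltonian_vector_unique x j k X : vsum I (pv x) != 0 ->
  cross (pv x j) (pv x k) != 0 -> hamiltonian_vector f x X ->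
  exists e, forall i, vec_of (X i) = bending_field I (pv x) i + cross e (pv x i).
Proof.
move=> n0 njk [[gamma0 hX] hham].
have [tX _] := velocity_tangent hX; have [_ [_ _ _ eX]] := velocity_elim hX.
have /choice[a ha] : forall i, exists a, vec_of (X i) = - 2 *: cross a (pv x i).
  by move=> i; apply: tangent_cross (pv_neq0 ell_gt0 _ _) (tX i).
pose b i := if i \in I then (- 2^-1 : R) *: axis I (pv x) else 0.
have [|e he] := @annihilator _ _ _ ell_gt0 x (fun i => a i - b i) j k njk.
  move=> gamma w hw; have [d1 h1 k1] := hham _ _ hw.
  have [d2 h2 k2] := (bending_field_hamiltonian n0).2 _ _ hw.
  have rE c : reduced_form x (fun i => mx_of (- 2 *: cross (c i) (pv x i))) w
      = \sum_i dot (c i) (vec_of (w i)) by exact: reduced_formE hw.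
  have e1 : reduced_form x X w = \sum_i dot (a i) (vec_of (w i)).
    by rewrite -rE; apply: eq_bigr => i _; rewrite -ha eX.
  have e2 : reduced_form x (fun i => mx_of (bending_field I (pv x) i)) w =
      \sum_i dot (b i) (vec_of (w i)).
    by rewrite -rE; apply: eq_bigr => i _; rewrite bending_fieldE.
  under eq_bigr do rewrite dotDl dotNl.
  rewrite sumrB -e1 -e2; apply/eqP; rewrite subr_eq0; apply/eqP.
  rewrite -(is_derive_uniq h1 h2) in k2.
  exact: addrI (etrans k1 (esym k2)).
exists (- 2 *: e) => i; rewrite ha bending_fieldE -/(b i) crossZl -scalerDr.
by congr (_ *: _); rewrite -he crossDl crossNl addrC subrK.
Qed.

(** Along an integral curve, the axis moves under the global infinitesimal
    rotation [e] alone, so that undoing the bending leaves a motion under [e].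
    *)
Lemma unbend_velocity (c : R -> polygon) t e :
  vsum I (pv (c t)) != 0 ->
  (forall i, vderiv (fun s => pv (c s) i) t
     (bending_field I (pv (c t)) i + cross e (pv (c t) i))) ->
  forall i, vderiv (fun s => bendv I (- s) (pv (c s)) i) t
     (cross e (bendv I (- t) (pv (c t)) i)).
Proof.
move=> n0 hc i.
have hv : vderiv (fun s => vsum I (pv (c s))) t (cross e (vsum I (pv (c t)))).
  apply: vderiv_eqv (vderiv_vsum hc) _.
  rewrite /vsum big_split -cross_sumr /= -[RHS]add0r; congr (_ + _).
  rewrite (eq_bigr (fun i => cross (axis I (pv (c t))) (pv (c t) i))).
    by rewrite -cross_sumr -/(vsum I _) crossZl crossvv scaler0.
  by move=> l lI; rewrite /bending_field lI.
have hd : is_derive t 1 (fun s => (vnorm (vsum I (pv (c s))))^-1) 0.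
  have h := is_derive_vnorm n0 hv.
  rewrite dotZl dot_cross_r mulr0 in h.
  have nv0 : vnorm (vsum I (pv (c t))) != 0 by rewrite vnorm_eq0.
  by apply: (is_derive_eqv (@is_derive_inv _
    (fun s => vnorm (vsum I (pv (c s)))) t _ nv0 h)); rewrite mulr0.
have ha : vderiv (fun s => axis I (pv (c s))) t (cross e (axis I (pv (c t)))).
  apply: vderiv_eqv (vderivZ hd hv) _.
  by rewrite scale0r addr0 -crossZr.
rewrite /bendv; have := hc i; rewrite /bending_field; case: (i \in I) => h.
  by apply: vderiv_unrotate => //; exact: axis_unit.
by rewrite add0r in h.
Qed.

Lemma class_eq_bendv x y t : polygon_class x = polygon_class y ->
  exists2 T, is_rotation T &
    forall i, bendv I t (pv y) i = T (bendv I t (pv x) i).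
Proof.
move=> /class_eq_is_rotation[T hT e]; exists T => // i.
by rewrite (eq_bendv I t e) (bendv_rotation I t (pv x) hT).
Qed.

Lemma class_bend x y t : vsum I (pv x) != 0 ->
  polygon_class x = polygon_class y ->
  polygon_class (bend I t x) = polygon_class (bend I t y).
Proof.
move=> n0 xy; have [T hT e] := class_eq_is_rotation xy.
have n1 : vsum I (pv y) != 0.
  by rewrite (eq_vsum I e) /vsum -(rotation_sum hT) (rotation_eq0 hT).
have [T' hT' e'] := class_eq_bendv t xy.
by apply: (class_eq_rotation hT') => i; rewrite !pv_bend.
Qed.

Variable U : set (polygon_space ell).
Hypothesis U_regular : forall x, U (polygon_class x) ->
  vsum I (pv x) != 0 /\ exists j k, cross (pv x j) (pv x k) != 0.
Hypothesis U_bend : forall x t, U (polygon_class x) ->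
  U (polygon_class (bend I t x)).

(** The lift of an integral curve that has a velocity at the time [t] depends
    on [t]. The functions [F] that are invariant under rotations take the same
    value on all lifts, so that the derivative can be computed along this one.
    *)
Lemma integral_curve_invariant (F : ('I_n -> vec R) -> R) gamma t :
  (forall T X X', is_rotation T -> X' =1 T \o X -> F X' = F X) ->
  (forall (c : R -> 'I_n -> vec R) s e,
     (forall i, vderiv (c^~ i) s (cross e (c s i))) ->
     is_derive s 1 (fun r => F (c r)) 0) ->
  integral_curve_at U f gamma t ->
  is_derive t 1 (fun s => F (bendv I (- s) (pv (repr (gamma s))))) 0.
Proof.
move=> hF hF' [Ut [x [X [hX hham]]]].
have [c [ct cg cX _]] := velocity_elim hX.
have gx : polygon_class x = gamma t by rewrite -ct (nbhs_singleton cg).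
rewrite -gx in Ut; have [n0 [j [k njk]]] := U_regular Ut.
have [e he] := hamiltonian_vector_unique n0 njk hham.
have hc i : vderiv (fun s => pv (c s) i) t
     (bending_field I (pv (c t)) i + cross e (pv (c t) i)).
  by rewrite ct -he.
rewrite -ct in n0; have hz := unbend_velocity n0 hc.
apply: is_derive_near_eq (hF' (fun s => bendv I (- s) (pv (c s))) t e hz).
apply: filterS cg => s cs.
have [T hT hs] := @class_eq_bendv (repr (gamma s)) (c s) (- s) (etrans (class_repr _) (esym cs)).
exact: hF hT hs.
Qed.

(** Uniqueness: along an integral curve, the scalar products and the triple
    products of the edges of the unbent polygon have zero derivative, hence
    are constant, and they determine its class. *)
Lemma bend_hamiltonian_flow Phi :
  (forall p t, U p -> Phi t p = polygon_class (bend I t (repr p))) ->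
  hamiltonian_flow U f Phi.
Proof.
move=> hPhi p Up; have Ur : U (polygon_class (repr p)) by rewrite class_repr.
have [n0 _] := U_regular Ur; split.
- by rewrite hPhi // bend0 // class_repr.
- move=> t; split; first by rewrite hPhi //; exact: U_bend.
  have -> : Phi^~ p = fun s => polygon_class (bend I s (repr p)).
    by apply/funext => s; exact: hPhi.
  have n1 : vsum I (pv (bend I t (repr p))) != 0.
    by have [] := U_regular (U_bend t Ur).
  exists (bend I t (repr p)), (fun i => mx_of
    (bending_field I (pv (bend I t (repr p))) i)); split.
    exact: bend_velocity.
  exact: bending_field_hamiltonian.
move=> gamma a b a0 b0 g0 hg t at_ tb.
pose z s := bendv I (- s) (pv (repr (gamma s))).
have z0 : z 0 =1 pv (repr p) by move=> i; rewrite /z oppr0 bendv0 g0.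
have inv (F : ('I_n -> vec R) -> R) :
  (forall T X X', is_rotation T -> X' =1 T \o X -> F X' = F X) ->
  (forall (c : R -> 'I_n -> vec R) s e,
     (forall i, vderiv (c^~ i) s (cross e (c s i))) ->
     is_derive s 1 (fun r => F (c r)) 0) -> F (z 0) = F (z t).
  move=> h1 h2; apply: (@constant_of_derive0 _ (fun s => F (z s)) a b).
  - move=> s /andP[as_ sb].
    exact: integral_curve_invariant h1 h2 (hg s as_ sb).
  - by rewrite a0 b0.
  - by rewrite at_ tb.
have [_ [j [k njk]]] := U_regular Ur.
have [|||g gS hz] := @congruent_of_invariants R 'I_n (z 0) (z t) j k.
- by rewrite !z0.
- move=> i i'; apply: (inv (fun Z => dot (Z i) (Z i'))) => [T X X' hT e|c s e hc].
    by rewrite !e /= (rotation_dot hT).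
  apply: (is_derive_eqv (is_derive_dot (hc i) (hc i'))); vec_ring.
- move=> i i' i''; apply: (inv (fun Z => dot (Z i) (cross (Z i') (Z i'')))).
    by move=> T X X' hT e; rewrite !e /= (rotation_cross hT) (rotation_dot hT).
  move=> c s e hc.
  apply: (is_derive_eqv (is_derive_dot (hc i) (vderiv_cross (hc i') (hc i'')))).
  vec_ring.
have Ug : U (polygon_class (repr (gamma t))).
  by rewrite class_repr; have [] := hg t at_ tb.
have [nt _] := U_regular Ug.
rewrite hPhi // -[LHS]class_repr; apply: esym.
apply: (class_eq_rotation (ad_is_rotation gS)) => i.
rewrite pv_bend // -(eq_bendv I t z0).
rewrite -[ad g _]/((ad g \o bendv I t (z 0)) i).
rewrite -(bendv_rotation I t (z 0) (ad_is_rotation gS)).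
rewrite -(eq_bendv I t hz) /z bendv_add // subrr bendv0 //.
Qed.

End BendingFlow.

(** * Angles modulo a full turn *)

Section Circle.
Variable R : realType.
Implicit Types (s t : R) (c d : circle R).

Lemma to_circle_repr c : to_circle (repr c) = c.
Proof. exact: reprK. Qed.

Lemma to_circleD s t : to_circle (s + t) = to_circle s + to_circle t.
Proof. exact: raddfD. Qed.

Lemma to_circle0 : to_circle (0 : R) = 0.
Proof. exact: raddf0. Qed.

Lemma to_circle_eqP s t : to_circle s = to_circle t <->
  exists k : int, s = t + (2 * pi) *~ k.
Proof.
have -> : (to_circle s = to_circle t) <-> (s - t \in @period_lattice R).
  by rewrite Quotient.idealrBE; split=> [e|/eqP //]; exact/eqP.
by split=> [/asboolP[k e]|[k ->]]; [exists k; rewrite -e addrC subrK|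
  apply/asboolP; exists k; rewrite addrC addKr].
Qed.

Lemma repr_to_circle t : exists k : int, repr (to_circle t) = t + (2 * pi) *~ k.
Proof. by apply/to_circle_eqP; rewrite to_circle_repr. Qed.

Lemma cos_periodz t (k : int) : cos (t + (2 * pi) *~ k) = cos t.
Proof.
rewrite mulr_natl; case: k => m.
  by rewrite -pmulrn (periodicn (@cosD2pi R)).
rewrite NegzE mulrNz -pmulrn -[in RHS](subrK (pi *+ 2 *+ m.+1) t).
by rewrite (periodicn (@cosD2pi R)).
Qed.

(** A rotation of the plane that fixes a non-zero vector has [cos t = 1]. For
    [t] reduced to the interval from [0] to [2 pi], this means [sin (t / 2) =
    0], hence [t = 0]. *)
Lemma rotation_fixed_point a b t : a ^+ 2 + b ^+ 2 != 0 :> R ->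
  cos t * a - sin t * b = a -> cos t * b + sin t * a = b ->
  to_circle t = 0.
Proof.
move=> n0 h1 h2; have c1 : cos t = 1.
  apply: (mulIf n0); rewrite mul1r -{2}[a ^+ 2]/(a * a) -{2}[b ^+ 2]/(b * b).
  by rewrite -{3}h1 -{3}h2; ring.
have tp : 0 < 2 * pi :> R by rewrite mulr_gt0 ?pi_gt0 // ltr0n.
pose k := Num.floor (t / (2 * pi)); pose r := t - (2 * pi) *~ k.
have r0 : 0 <= r.
  by rewrite subr_ge0 -mulrzr mulrC -ler_pdivlMr // floor_le.
have r1 : r < 2 * pi.
  rewrite ltrBlDr -{1}[2 * pi]mulr1 -mulrzr -mulrDr mulrC -ltr_pdivrMr // addrC.
  by have := floorD1_gt (t / (2 * pi)); rewrite intrD.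
have cr : cos r = 1.
  by rewrite -c1 /r -mulrNz cos_periodz.
have {}r0 : r = 0.
  apply/eqP; move: r0; rewrite le_eqVlt eq_sym => /orP[//|r0].
  have : 0 < sin (r / 2) by rewrite sin_gt0_pi // divr_gt0 //= ltr_pdivrMr // mulrC.
  have e : r / 2 *+ 2 = r by rewrite -mulr_natr divfK // pnatr_eq0.
  have := cos_mulr2n (r / 2); rewrite e cr cos2sin2 => h hs.
  have : sin (r / 2) ^+ 2 = 0 by lra.
  by move=> /eqP; rewrite sqrf_eq0 gt_eqF.
rewrite -to_circle0; apply/to_circle_eqP; exists k.
by move: r0 => /eqP; rewrite subr_eq0 add0r => /eqP.
Qed.

(** The matrix of the rotation is given by the scalar product and the
    determinant of the two vectors. *)
Lemma rotation_transitive a b a' b' : a ^+ 2 + b ^+ 2 != 0 :> R ->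
  a ^+ 2 + b ^+ 2 = a' ^+ 2 + b' ^+ 2 ->
  exists t, cos t * a - sin t * b = a' /\ cos t * b + sin t * a = b'.
Proof.
move=> n0 e; set r := a ^+ 2 + b ^+ 2 in n0 e.
pose c := (a * a' + b * b') / r; pose s := (a * b' - b * a') / r.
have cs : c ^+ 2 + s ^+ 2 = 1.
  have -> : c ^+ 2 + s ^+ 2 = r * (a' ^+ 2 + b' ^+ 2) / r ^+ 2.
    by rewrite /c /s /r; field.
  by rewrite -e; field.
have ha : c * a - s * b = a' by rewrite /c /s /r; field.
have hb : c * b + s * a = b' by rewrite /c /s /r; field.
have c1 : -1 <= c <= 1.
  rewrite -ler_norml -(@ler_pXn2r _ 2) ?nnegrE ?ler01 //.
  by rewrite expr1n real_normK ?num_real // -cs lerDl sqr_ge0.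
have sc : Num.sqrt (1 - c ^+ 2) = `|s| by rewrite -cs addrAC subrr add0r sqrtr_sqr.
case: (lerP 0 s) => s0.
  exists (acos c); rewrite acosK ?in_itv // sin_acos // sc ger0_norm //.
exists (- acos c); rewrite cosN sinN acosK ?in_itv // sin_acos // sc.
by rewrite ltr0_norm // opprK.
Qed.

End Circle.

(** Moving a single coordinate is continuous for the product topology. *)
Lemma interior_coordinate (R : realType) (I : finType) (D : set {ptws I -> R})
    (d : I -> R) (a : I) : interior D d ->
  exists2 e : R, 0 < e & forall s, `|s - d a| < e -> D (dfwith d a s).
Proof.
move=> Dd; have h := @dfwith_continuous I (fun=> R) d a (d a).
have dd : dfwith d a (d a) = d :> (I -> R).
  apply/funext => i; case: (eqVneq a i) => [<-|ai]; first by rewrite dfwithin.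
  by rewrite dfwithout.
have : \forall s \near d a, D (dfwith d a s).
  by apply: h; rewrite dd.
move=> /nbhs_ballP[e /= e0 he]; exists e => // s hs; apply: he.
by rewrite /ball /= distrC.
Qed.

(** * The bending flows of an admissible graph *)

Section GraphBending.
Import boot.fintype boot.finset.
Variables (R : realType) (n : nat) (G : admissible_graph n).
Implicit Types (X : 'I_n -> vec R) (v w p q : vertex G) (f : flag G) (s t : R).

(** The diagonal that cuts off the half-edges beyond [f], or an edge of the
    polygon if [f] is a half-edge. *)
Definition chord X v f : vec R := vsum (tips v f) X.

(** The conditions that define [Mstar], for a chain of vectors. *)
Definition regular X : Prop := (exists j k, cross (X j) (X k) != 0) /\
  forall v w, adj v w -> chord X v (inl w) != 0.

Lemma chord_opposite X v w : \sum_i X i = 0 -> adj v w ->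
  chord X w (inl v) = - chord X v (inl w).
Proof. by move=> X0 vw; rewrite /chord tips_compl // vsumC. Qed.

Lemma chord_rotation T X v f : is_rotation T ->
  chord (T \o X) v f = T (chord X v f).
Proof. by move=> hT; rewrite /chord /vsum (rotation_sum hT). Qed.

Lemma eq_chord X X' v f : X =1 X' -> chord X v f = chord X' v f.
Proof. exact: eq_vsum. Qed.

Lemma chord_bendv_away X p q v f t : chord X p (inl q) != 0 ->
  v \notin branch p q -> star v f ->
  chord (bendv (tips p (inl q)) t X) v f = chord X v f.
Proof.
move=> n0 vb vf; case: (tips_away vb vf) => h.
  exact: vsum_bendv_superset.
exact: vsum_bendv_disjoint.
Qed.

(** If [v] lies on the bent side, bend the other side instead: this changes
    the chain by a global rotation. *)
Lemma vnorm_chord_bendv X p q v f t : \sum_i X i = 0 ->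
  chord X p (inl q) != 0 -> adj p q -> star v f ->
  vnorm (chord (bendv (tips p (inl q)) t X) v f) = vnorm (chord X v f).
Proof.
move=> X0 n0 pq vf; case: (boolP (v \in branch p q)) => vb; last first.
  by rewrite chord_bendv_away.
have hT := turn_is_rotation (axis_unit n0) t.
rewrite (eq_chord _ _ (bendv_compl t n0 X0)) chord_rotation //.
rewrite (rotation_vnorm hT) -tips_compl // chord_bendv_away //.
  by rewrite chord_opposite // oppr_eq0.
by rewrite branch_compl // in_setC negbK.
Qed.

(** A collinear chain lies along its diagonal, hence is fixed by the bending
    about it and by the inverse bending. *)
Lemma noncollinear_bendv X I t : vsum I X != 0 ->
  (exists j k, cross (X j) (X k) != 0) ->
  exists j k, cross (bendv I t X j) (bendv I t X k) != 0.
Proof.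
move=> n0 [j [k njk]]; apply: contrapT => h.
set X' := bendv I t X in h.
have c0 a b : cross (X' a) (X' b) = 0.
  by apply: contrapT => /eqP nab; apply: h; exists a, b.
have sX' : vsum I X' = vsum I X by rewrite vsum_bendv_superset.
have fixed i : X i = X' i.
  have e : X i = bendv I (- t) X' i by rewrite bendv_add // addNr bendv0.
  rewrite e /bendv; case: ifP => // _.
  have n1 : vsum I X' != 0 by rewrite sX'.
  have /(cross_eq0_collinear n1) -> : cross (vsum I X') (X' i) = 0.
    by rewrite crossC cross_sumr big1 ?oppr0 // => l _; exact: c0.
  by rewrite -(normalizeK n1) -/(axis I X') scalerA turn_axis // axis_unit.
by move: njk; rewrite !fixed c0 eqxx.
Qed.

Lemma regular_bendv X p q t : \sum_i X i = 0 -> adj p q -> regular X ->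
  regular (bendv (tips p (inl q)) t X).
Proof.
move=> X0 pq [h1 h2]; have n0 := h2 _ _ pq; split.
  exact: noncollinear_bendv.
by move=> v w vw; rewrite -vnorm_eq0 vnorm_chord_bendv // vnorm_eq0 h2.
Qed.

End GraphBending.

Section BendingFlows.
Import boot.fintype boot.finset.
Variables (R : realType) (n : nat) (G : admissible_graph n) (ell : 'I_n -> R).
Hypothesis ell_gt0 : forall i, 0 < ell i.
Variable i0 : 'I_n.
Local Notation polygon := (closed_polygon ell).
Local Notation space := (polygon_space ell).
Implicit Types (x y : polygon) (p q : space) (v w : vertex G) (a b : Eint G)
  (s t : R).

Lemma initial_tips a : exists v w, ends a v w /\
  initial_half_edges a = tips v (inl w).
Proof.
have [v [w avw]] := ends_exist a.
have [e|e] := initial_half_edgesE avw; first by exists v, w.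
exists w, v; split; first exact: ends_sym.
by rewrite e (tips_compl (ends_adj avw)).
Qed.

Lemma lambda_initial a x :
  lambda a (polygon_class x) = vnorm (vsum (initial_half_edges a) (pv x)).
Proof.
rewrite /lambda; set y := repr _.
have [T hT e] : exists2 T, is_rotation T & forall i, pv y i = T (pv x i).
  by apply: class_eq_is_rotation; rewrite class_repr.
under eq_bigr do rewrite -mx_pv.
rewrite -mx_of_sum snorm_mx_of -/(vsum _ (pv y)) (eq_vsum _ e) /vsum.
by rewrite -(rotation_sum hT) (rotation_vnorm hT).
Qed.

Lemma lambda_chord a v w x : ends a v w ->
  lambda a (polygon_class x) = vnorm (chord (pv x) v (inl w)).
Proof.
move=> avw; rewrite lambda_initial; have [->//|->] := initial_half_edgesE avw.
by rewrite vsumC ?pv_sum // vnormN.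
Qed.

Lemma Mstar_regular x : Mstar G ell (polygon_class x) <-> regular G (pv x).
Proof.
split=> [[ns hl]|[ns hd]].
  split=> [|v w vw]; first exact/(singularP x (ell_gt0 i0)).
  have [a avw] := edge_between vw; rewrite -vnorm_eq0 -(lambda_chord x avw).
  exact/eqP.
split=> [|a]; first exact/(singularP x (ell_gt0 i0)).
have [v [w avw]] := ends_exist a; rewrite (lambda_chord x avw).
by apply/eqP; rewrite vnorm_eq0 hd // (ends_adj avw).
Qed.

Definition Phi a t p : space :=
  polygon_class (bend (initial_half_edges a) t (repr p)).

Lemma class_bend_compl I x t : vsum I (pv x) != 0 ->
  polygon_class (bend (~: I) t x) = polygon_class (bend I t x).
Proof.
move=> n0; have n1 : vsum (~: I) (pv x) != 0 by rewrite vsumC ?pv_sum // oppr_eq0.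
apply: (class_eq_rotation (turn_is_rotation (axis_unit n0) t)) => i.
exact (etrans (pv_bend t n0 i) (etrans (bendv_compl t n0 (pv_sum x) i)
  (congr1 _ (esym (pv_bend t n1 i))))).
Qed.

Lemma class_bend_add (I : {set 'I_n}) s t x : vsum I (pv x) != 0 ->
  polygon_class (bend I s (bend I t x)) = polygon_class (bend I (s + t) x).
Proof.
move=> n0; apply: class_eq_pv => i.
have n1 : vsum I (pv (bend I t x)) != 0.
  by rewrite (eq_vsum _ (pv_bend t n0)) vsum_bendv_superset.
rewrite (pv_bend s n1) (eq_bendv I s (pv_bend t n0)) (bendv_add s t n0).
by rewrite (pv_bend (s + t) n0).
Qed.

Lemma class_bend_periodic (I : {set 'I_n}) t x : vsum I (pv x) != 0 ->
  polygon_class (bend I (t + 2 * pi) x) = polygon_class (bend I t x).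
Proof.
move=> n0; apply: class_eq_pv => i.
by rewrite (pv_bend _ n0) bendv_periodic (pv_bend t n0).
Qed.

Lemma class_bend_comm (I J : {set 'I_n}) s t x :
  vsum I (pv (bend J t x)) != 0 -> vsum J (pv (bend I s x)) != 0 ->
  vsum I (pv x) != 0 -> vsum J (pv x) != 0 ->
  J \subset I \/ J \subset ~: I ->
  polygon_class (bend I s (bend J t x)) = polygon_class (bend J t (bend I s x)).
Proof.
move=> nIJ nJI nI nJ IJ; apply: class_eq_pv => i.
rewrite (pv_bend s nIJ) (pv_bend t nJI) (eq_bendv I s (pv_bend t nJ)).
rewrite (eq_bendv J t (pv_bend s nI)); case: IJ => h.
  by rewrite (bendv_comm_subset t s nJ nI h).
by rewrite (bendv_comm_disjoint t s (pv x) h).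
Qed.

(** Bending one side of [a] or the other gives the same class. *)
Lemma Phi_class a v w x t : ends a v w -> regular G (pv x) ->
  Phi a t (polygon_class x) = polygon_class (bend (tips v (inl w)) t x).
Proof.
move=> avw [_ hd]; have n0 := hd _ _ (ends_adj avw).
have e : polygon_class x = polygon_class (repr (polygon_class x)).
  by rewrite class_repr.
rewrite /Phi; have [->|->] := initial_half_edgesE avw.
  by rewrite -(class_bend t n0 e).
have n1 : vsum (~: tips v (inl w)) (pv x) != 0.
  by rewrite vsumC ?pv_sum // oppr_eq0.
exact (etrans (esym (class_bend t n1 e)) (class_bend_compl t n0)).
Qed.

Lemma pv_bend_tips v w x t : regular G (pv x) -> adj v w ->
  pv (bend (tips v (inl w)) t x) =1 bendv (tips v (inl w)) t (pv x).
Proof. by move=> [_ hd] vw; apply: pv_bend; apply: hd. Qed.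

Lemma eq_regular (X X' : 'I_n -> vec R) : X =1 X' -> regular G X -> regular G X'.
Proof. by move=> /funext ->. Qed.

Lemma regular_bend v w x t : regular G (pv x) -> adj v w ->
  regular G (pv (bend (tips v (inl w)) t x)).
Proof.
move=> rx vw; have /eq_regular := pv_bend_tips t rx vw.
by rewrite (funext (pv_bend_tips t rx vw)) => _; apply: regular_bendv; rewrite ?pv_sum.
Qed.

Lemma Phi_Mstar a t p : Mstar G ell p -> Mstar G ell (Phi a t p).
Proof.
rewrite -(class_repr p) => /Mstar_regular rx.
have [v [w avw]] := ends_exist a; rewrite (Phi_class t avw rx).
by apply/Mstar_regular/regular_bend => //; apply: ends_adj avw.
Qed.

Lemma vsum_initial_neq0 a x : regular G (pv x) ->
  vsum (initial_half_edges a) (pv x) != 0.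
Proof.
move=> [_ hd]; have [v [w [avw ->]]] := initial_tips a.
exact/hd/ends_adj/avw.
Qed.

Lemma Phi_hamiltonian a :
  hamiltonian_flow (Mstar G ell) (fun p => 2^-1 * lambda a p) (Phi a).
Proof.
have fE x : 2^-1 * lambda a (polygon_class x) =
    2^-1 * vnorm (vsum (initial_half_edges a) (pv x)) by rewrite lambda_initial.
have regU x : Mstar G ell (polygon_class x) ->
    vsum (initial_half_edges a) (pv x) != 0 /\
    exists j k, cross (pv x j) (pv x k) != 0.
  by move=> /Mstar_regular rx; split; [exact: vsum_initial_neq0|case: rx].
have bendU x t : Mstar G ell (polygon_class x) ->
    Mstar G ell (polygon_class (bend (initial_half_edges a) t x)).
  move=> /Mstar_regular rx; apply/Mstar_regular.
  have [v [w [avw ->]]] := initial_tips a.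
  exact: regular_bend rx (ends_adj avw).
exact: (@bend_hamiltonian_flow _ _ _ ell_gt0 _ (fun p => 2^-1 * lambda a p) fE
  (Mstar G ell) regU bendU (Phi a) (fun p t _ => erefl)).
Qed.

Lemma Phi_add a s t p : Mstar G ell p -> Phi a s (Phi a t p) = Phi a (s + t) p.
Proof.
rewrite -(class_repr p) => /Mstar_regular rx; set x := repr p in rx *.
have [v [w avw]] := ends_exist a; have vw := ends_adj avw.
have rt := regular_bend t rx vw.
rewrite (Phi_class t avw rx) (Phi_class s avw rt) (Phi_class (s + t) avw rx).
exact (class_bend_add s t (rx.2 _ _ vw)).
Qed.

Lemma Phi0 a p : Mstar G ell p -> Phi a 0 p = p.
Proof.
move=> Mp; have := Mp; rewrite -(class_repr p) => /Mstar_regular rx.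
rewrite class_repr /Phi bend0 ?class_repr //; exact: vsum_initial_neq0.
Qed.

Lemma Phi_periodic a t p : Mstar G ell p -> Phi a (t + 2 * pi) p = Phi a t p.
Proof.
rewrite -(class_repr p) => /Mstar_regular rx; set x := repr p in rx *.
have [v [w avw]] := ends_exist a; have vw := ends_adj avw.
rewrite (Phi_class _ avw rx) (Phi_class t avw rx).
exact (class_bend_periodic t (rx.2 _ _ vw)).
Qed.

Lemma Phi_periodz a t (k : int) p : Mstar G ell p ->
  Phi a (t + (2 * pi) *~ k) p = Phi a t p.
Proof.
move=> Mp; have per m u : Phi a (u + (2 * pi) *+ m) p = Phi a u p.
  elim: m => [|m IH]; first by rewrite mulr0n addr0.
  by rewrite mulrSr addrA (Phi_periodic a _ Mp) IH.
case: k => m; first by rewrite -pmulrn per.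
by rewrite NegzE mulrNz -pmulrn -[in RHS](subrK ((2 * pi) *+ m.+1) t) per.
Qed.

(** The two flows can be realised by bending nested or disjoint sets of edges.
    *)
Lemma Phi_comm a b s t p : Mstar G ell p ->
  Phi a s (Phi b t p) = Phi b t (Phi a s p).
Proof.
move=> Mp; case: (eqVneq a b) => [->|ab]; first by rewrite !(Phi_add b _ _ Mp) addrC.
move: Mp; rewrite -(class_repr p) => /Mstar_regular rx; set x := repr p in rx *.
have [v [w avw]] := ends_exist a; have vw := ends_adj avw.
have [v' [w' [bvw vb _]]] := other_edge_side avw ab.
have vw' := ends_adj bvw.
have rxa := regular_bend s rx vw; have rxb := regular_bend t rx vw'.
rewrite (Phi_class _ avw rx) (Phi_class _ bvw rx).
rewrite (Phi_class _ avw rxb) (Phi_class _ bvw rxa).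
exact (class_bend_comm (rxb.2 _ _ vw) (rxa.2 _ _ vw') (rx.2 _ _ vw)
  (rx.2 _ _ vw') (tips_away vb (vw : star v (inl w)))).
Qed.

Lemma lambda_Phi a b t p : Mstar G ell p -> lambda a (Phi b t p) = lambda a p.
Proof.
rewrite -(class_repr p) => /Mstar_regular rx; set x := repr p in rx *.
have [v [w avw]] := ends_exist a; have [v' [w' bvw]] := ends_exist b.
rewrite (Phi_class t bvw rx) !(lambda_chord _ avw).
rewrite (eq_chord _ _ (pv_bend_tips t rx (ends_adj bvw))).
have n0 := rx.2 _ _ (ends_adj bvw).
by rewrite vnorm_chord_bendv ?pv_sum ?(ends_adj bvw) //; apply: ends_adj avw.
Qed.

(** The list [r] is arbitrary for the sake of induction; the torus acts
    through the list of all the internal edges. *)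
Definition flow (r : seq (Eint G)) (tau : Eint G -> R) p : space :=
  foldr (fun a q => Phi a (tau a) q) p r.

Lemma flow_Mstar r tau p : Mstar G ell p -> Mstar G ell (flow r tau p).
Proof.
move=> Mp; elim: r => [|a r IH] /=; first exact Mp.
exact (Phi_Mstar a (tau a) IH).
Qed.

Lemma lambda_flow a r tau p : Mstar G ell p -> lambda a (flow r tau p) = lambda a p.
Proof.
move=> Mp; elim: r => [|b r IH] /=; first by [].
exact (etrans (lambda_Phi a b (tau b) (flow_Mstar r tau Mp)) IH).
Qed.

Lemma flow_Phi a t r tau p : Mstar G ell p ->
  Phi a t (flow r tau p) = flow r tau (Phi a t p).
Proof.
move=> Mp; elim: r => [|b r IH] /=; first by [].
by rewrite (Phi_comm a b _ _ (flow_Mstar r tau Mp)) IH.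
Qed.

Lemma flow_add r tau sigma p : Mstar G ell p ->
  flow r (fun a => tau a + sigma a) p = flow r tau (flow r sigma p).
Proof.
move=> Mp; elim: r => [|a r IH] /=; first by [].
have Ms := flow_Mstar r sigma Mp.
by rewrite IH -(Phi_add a _ _ (flow_Mstar r tau Ms)) (flow_Phi a (sigma a) r tau Ms).
Qed.

Lemma flow_mod r tau sigma p : Mstar G ell p ->
  (forall a, exists k : int, tau a = sigma a + (2 * pi) *~ k) ->
  flow r tau p = flow r sigma p.
Proof.
move=> Mp h; elim: r => [|a r IH] /=; first by [].
by rewrite IH; have [k ->] := h a; rewrite (Phi_periodz a _ k (flow_Mstar r sigma Mp)).
Qed.

Lemma flow_single r a t p : Mstar G ell p -> uniq r ->
  flow r (fun b => if b == a then t else 0) p = if a \in r then Phi a t p else p.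
Proof.
move=> Mp; elim: r => [|b r IH] /=; first by [].
move=> /andP[br /IH ->]; rewrite inE (eq_sym a).
case: (eqVneq b a) => [ba|_] /=; first by rewrite -ba (negbTE br).
by case: (a \in r); rewrite ?(Phi0 b (Phi_Mstar a t Mp)) ?(Phi0 b Mp).
Qed.

(** By [flow_mod], the result does not depend on the representatives of the
    coordinates of [g]. *)
Definition act (g : {ffun Eint G -> circle R}) p : space :=
  flow (enum (Eint G)) (fun a => repr (g a)) p.

Lemma act_to_circle (tau : Eint G -> R) (g : {ffun Eint G -> circle R}) p :
  Mstar G ell p -> (forall a, g a = to_circle (tau a)) ->
  act g p = flow (enum (Eint G)) tau p.
Proof.
by move=> Mp h; apply: flow_mod => // a; rewrite h; exact: repr_to_circle.
Qed.

Lemma act_Mstar g p : Mstar G ell p -> Mstar G ell (act g p).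
Proof. exact: flow_Mstar. Qed.

Lemma act0 p : Mstar G ell p -> act 0 p = p.
Proof.
move=> Mp; rewrite (@act_to_circle (fun=> 0) _ _ Mp) => [|a]; last first.
  by rewrite ffunE to_circle0.
elim: (enum _) => [|a r IH] /=; first by [].
by rewrite IH Phi0.
Qed.

Lemma actD g h p : Mstar G ell p -> act (g + h) p = act g (act h p).
Proof.
move=> Mp; rewrite (@act_to_circle (fun a => repr (g a) + repr (h a)) _ _ Mp).
  exact: flow_add.
by move=> a; rewrite ffunE to_circleD !to_circle_repr.
Qed.

Lemma act_torus_coord a t p : Mstar G ell p -> act (torus_coord a t) p = Phi a t p.
Proof.
move=> Mp; rewrite (@act_to_circle (fun b => if b == a then t else 0) _ _ Mp).
  by rewrite (flow_single a t Mp (enum_uniq _)) mem_enum.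
by move=> b; rewrite ffunE; case: (b == a); rewrite ?to_circle0.
Qed.

End BendingFlows.

(** * Dihedral angles and rigidity *)

Section Dihedral.
Variable R : realType.
Implicit Types (u y z : vec R) (t : R).

(** Cosine and sine, up to a common factor, of the dihedral angle about the
    unit axis [u] between the half-planes that contain [y] and [z]. *)
Definition dihedral_cos u y z : R := dot y z - dot u y * dot u z.
Definition dihedral_sin u y z : R := dot u (cross y z).

Lemma dihedral_cos_turn u y z t : dot u u = 1 ->
  dihedral_cos u y (turn u t z) =
  cos t * dihedral_cos u y z - sin t * dihedral_sin u y z.
Proof.
move=> u1; have e : dihedral_cos u y (turn u t z) =
    cos t * dihedral_cos u y z - sin t * dihedral_sin u y z
    - (dot u u - 1) * ((1 - cos t) * dot u z * dot u y).
  by rewrite /dihedral_cos /dihedral_sin; vec_ring.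
by rewrite e u1 subrr mul0r subr0.
Qed.

Lemma dihedral_sin_turn u y z t : dot u u = 1 ->
  dihedral_sin u y (turn u t z) =
  cos t * dihedral_sin u y z + sin t * dihedral_cos u y z.
Proof.
move=> u1; have e : dihedral_sin u y (turn u t z) =
    cos t * dihedral_sin u y z + sin t * dihedral_cos u y z
    + (dot u u - 1) * (sin t * dot y z).
  by rewrite /dihedral_cos /dihedral_sin; vec_ring.
by rewrite e u1 subrr mul0r addr0.
Qed.

Lemma dihedral_radius u y z : dot u u = 1 ->
  dihedral_cos u y z ^+ 2 + dihedral_sin u y z ^+ 2 =
  dot (cross u y) (cross u y) * dot (cross u z) (cross u z).
Proof.
move=> u1; have e : dihedral_cos u y z ^+ 2 + dihedral_sin u y z ^+ 2 =
    dot (cross u y) (cross u y) * dot (cross u z) (cross u z)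
    + (dot u u - 1) * (dot y y * dot u z ^+ 2 + dot z z * dot u y ^+ 2
       - dot u u * dot y y * dot z z - dot y z ^+ 2).
  by rewrite /dihedral_cos /dihedral_sin; vec_ring.
by rewrite e u1 subrr mul0r addr0.
Qed.

End Dihedral.

Section Hinges.
Import boot.fintype boot.finset.
Variables (R : realType) (n : nat) (G : admissible_graph n).
Implicit Types (X Y : 'I_n -> vec R) (v w p q : vertex G) (f g : flag G)
  (a b : Eint G) (s t : R).

(** The two triangles that share the diagonal [a], with a further side of
    each. *)
Definition hinge a v w f g : Prop :=
  [/\ ends a v w, star v f, f != inl w, star w g & g != inl v].

Lemma hinge_exists a : exists v w f g, hinge a v w f g.
Proof.
have [v [w avw]] := ends_exist a; have vw := ends_adj avw.
have [f [f' [vf _ /= + _]]] := star3 (vw : star v (inl w)).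
rewrite inE negb_or => /andP[/andP[nf _] _].
have wv : star w (inl v) by rewrite /= adj_sym.
have [g [g' [wg _ /= + _]]] := star3 wv.
rewrite inE negb_or => /andP[/andP[ng _] _].
by exists v, w, f, g; split=> //; rewrite eq_sym.
Qed.

Definition hinge_cos v w f g X : R :=
  dihedral_cos (axis (tips v (inl w)) X) (chord X v f) (chord X w g).
Definition hinge_sin v w f g X : R :=
  dihedral_sin (axis (tips v (inl w)) X) (chord X v f) (chord X w g).

Lemma hinge_rotation v w f g X T : is_rotation T ->
  hinge_cos v w f g (T \o X) = hinge_cos v w f g X /\
  hinge_sin v w f g (T \o X) = hinge_sin v w f g X.
Proof.
move=> hT; rewrite /hinge_cos /hinge_sin !chord_rotation //.
have -> : axis (tips v (inl w)) (T \o X) = T (axis (tips v (inl w)) X).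
  by rewrite /axis (rotation_normalize hT) -(chord_rotation _ _ _ hT).
by rewrite /dihedral_cos /dihedral_sin (rotation_cross hT) !(rotation_dot hT).
Qed.

(** The bent side contains [tips w g] and is disjoint from [tips v f]: one of
    the two triangles turns about the common side while the other one is
    fixed. *)
Lemma hinge_bend_self a v w f g X t : hinge a v w f g ->
  chord X v (inl w) != 0 -> let X' := bendv (tips v (inl w)) t X in
  hinge_cos v w f g X' =
    cos t * hinge_cos v w f g X - sin t * hinge_sin v w f g X /\
  hinge_sin v w f g X' =
    cos t * hinge_sin v w f g X + sin t * hinge_cos v w f g X.
Proof.
move=> [avw vf fw wg gv] n0 /=; have vw := ends_adj avw.
rewrite /hinge_cos /hinge_sin axis_bendv_superset //.
have -> : chord (bendv (tips v (inl w)) t X) v f = chord X v f.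
  have wf : inl w != f by rewrite eq_sym.
  exact: vsum_bendv_disjoint (tips_disjoint (vw : star v (inl w)) vf wf).
have -> : chord (bendv (tips v (inl w)) t X) w g =
    turn (axis (tips v (inl w)) X) t (chord X w g).
  apply: vsum_bendv_subset => //.
  have -> : tips v (inl w) = ~: tips w (inl v) by rewrite (tips_compl vw) setCK.
  by apply: tips_disjoint => //=; rewrite adj_sym.
have u1 := axis_unit n0.
by rewrite dihedral_cos_turn // dihedral_sin_turn.
Qed.

(** The far side of another edge can be bent without moving the diagonals at
    [v] and [w]. *)
Lemma hinge_bend_away a v w f g X p q t : hinge a v w f g ->
  chord X p (inl q) != 0 -> v \notin branch p q -> w \notin branch p q ->
  let X' := bendv (tips p (inl q)) t X in
  hinge_cos v w f g X' = hinge_cos v w f g X /\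
  hinge_sin v w f g X' = hinge_sin v w f g X.
Proof.
move=> [avw vf fw wg gv] n0 vb wb /=; have vw := ends_adj avw.
have h : axis (tips v (inl w)) (bendv (tips p (inl q)) t X) =
    axis (tips v (inl w)) X.
  by rewrite /axis; congr normalize; exact: chord_bendv_away.
by rewrite /hinge_cos /hinge_sin h !chord_bendv_away.
Qed.

Definition nonflat X : Prop := forall v f g, star v f -> star v g ->
  f != g -> cross (chord X v f) (chord X v g) != 0.

Lemma chord3 X v f f' f'' : \sum_i X i = 0 ->
  star v f -> star v f' -> star v f'' -> uniq [:: f; f'; f''] ->
  chord X v f'' = - (chord X v f + chord X v f').
Proof.
move=> X0 h h' h'' u; have := star3_sum X h h' h'' u; rewrite X0 => /eqP.
by rewrite addrC addr_eq0 => /eqP.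
Qed.

Lemma third_flag v f g : star v f -> star v g -> f != g ->
  exists2 h, star v h & uniq [:: f; g; h].
Proof.
move=> vf vg fg; have [h [h' [vh vh' u hall]]] := star3 vf.
have := hall _ vg; rewrite !inE eq_sym (negbTE fg) /= => /orP[]/eqP->.
  by exists h'.
exists h => //; move: u; rewrite /= !inE !negb_or !andbT.
by move=> /andP[/andP[-> ->]]; rewrite eq_sym => ->.
Qed.

Section SameLengths.
Variables (X Y : 'I_n -> vec R).
Hypotheses (X0 : \sum_i X i = 0) (Y0 : \sum_i Y i = 0).
Hypothesis same_length : forall v f, star v f ->
  vnorm (chord X v f) = vnorm (chord Y v f).

Lemma chord_sqr v f : star v f ->
  dot (chord X v f) (chord X v f) = dot (chord Y v f) (chord Y v f).
Proof. by move=> vf; rewrite -!vnorm_sqr same_length. Qed.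

(** The lengths of the sides of a triangle determine the scalar products. *)
Lemma chord_gram v f g : star v f -> star v g ->
  dot (chord X v f) (chord X v g) = dot (chord Y v f) (chord Y v g).
Proof.
move=> vf vg; case: (eqVneq f g) => [->|fg]; first exact: chord_sqr.
have [h vh u] := third_flag vf vg fg.
have := chord_sqr vh; rewrite (chord3 X0 vf vg vh u) (chord3 Y0 vf vg vh u).
rewrite !dotNl !dotNr !opprK !dotDl !dotDr (chord_sqr vf) (chord_sqr vg).
rewrite (dotC (chord X v g)) (dotC (chord Y v g) (chord Y v f)).
lra.
Qed.

Lemma hinge_axis_dot v w f : adj v w -> star v f ->
  dot (axis (tips v (inl w)) X) (chord X v f) =
  dot (axis (tips v (inl w)) Y) (chord Y v f).
Proof.
move=> vw vf; rewrite /axis /normalize -!/(chord _ v (inl w)) !dotZl.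
by rewrite same_length // chord_gram.
Qed.

Lemma hinge_axis_dot_opposite v w g : adj v w -> star w g ->
  dot (axis (tips v (inl w)) X) (chord X w g) =
  dot (axis (tips v (inl w)) Y) (chord Y w g).
Proof.
move=> vw wg; have wv : star w (inl v) by rewrite /= adj_sym.
have e (Z : 'I_n -> vec R) : \sum_i Z i = 0 ->
    axis (tips v (inl w)) Z = - axis (tips w (inl v)) Z.
  by move=> Z0; rewrite /axis -normalizeN -[vsum _ _]/(chord Z v (inl w))
    (chord_opposite Z0 (wv : adj w v)).
rewrite (e X X0) (e Y Y0) !dotNl; congr (- _).
exact: (hinge_axis_dot (wv : adj w v)).
Qed.

Hypotheses (X_nondeg : nonflat X) (Y_nondeg : nonflat Y).

Lemma chord_neq0 v w : adj v w ->
  chord X v (inl w) != 0 /\ chord Y v (inl w) != 0.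
Proof.
move=> vw; have [f [f' [vf _ /= + _]]] := star3 (vw : star v (inl w)).
rewrite inE negb_or => /andP[/andP[nf _] _].
split; apply: (@cross_neq0_l _ _ (chord _ v f)).
  exact: X_nondeg.
exact: Y_nondeg.
Qed.

Lemma hinge_radius a v w f g : hinge a v w f g ->
  hinge_cos v w f g X ^+ 2 + hinge_sin v w f g X ^+ 2 != 0 /\
  hinge_cos v w f g X ^+ 2 + hinge_sin v w f g X ^+ 2 =
  hinge_cos v w f g Y ^+ 2 + hinge_sin v w f g Y ^+ 2.
Proof.
move=> [avw vf fw wg gv]; have vw := ends_adj avw.
have [nX nY] := chord_neq0 vw.
have uX := axis_unit nX; have uY := axis_unit nY.
rewrite /hinge_cos /hinge_sin !dihedral_radius //; split; last first.
  rewrite !cross_sqr uX uY hinge_axis_dot // hinge_axis_dot_opposite //.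
  by rewrite (chord_sqr vf) (chord_sqr wg).
have wv : star w (inl v) by rewrite /= adj_sym.
rewrite mulf_neq0 // dot_eq0 /axis /normalize crossZl.
  rewrite scaler_eq0 negb_or invr_eq0 vnorm_eq0 nX.
  by apply: X_nondeg => //; rewrite eq_sym.
rewrite scaler_eq0 negb_or invr_eq0 vnorm_eq0 nX.
rewrite -[vsum _ _]/(chord X v (inl w)) (chord_opposite X0 (wv : adj w v)).
by rewrite crossNl oppr_eq0; apply: X_nondeg => //; rewrite eq_sym.
Qed.

(** The angles of all the hinges and the lengths of all the diagonals
    determine the polygon up to a rotation: a rotation that superposes the
    triangles at a vertex superposes those at its neighbours, and the tree is
    connected. *)
Lemma rigidity (v0 : vertex G) :
  (forall a, exists v w f g, [/\ hinge a v w f g,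
     hinge_cos v w f g X = hinge_cos v w f g Y &
     hinge_sin v w f g X = hinge_sin v w f g Y]) ->
  exists2 T, is_rotation T & forall i, Y i = T (X i).
Proof.
move=> hh.
pose superposed T v := forall f, star v f -> chord Y v f = T (chord X v f).
have complete T v f g : is_rotation T -> star v f -> star v g -> f != g ->
    chord Y v f = T (chord X v f) ->
    chord Y v g = T (chord X v g) -> superposed T v.
  move=> hT vf vg fg ef eg h vh.
  case: (eqVneq h f) => [->//|hf]; case: (eqVneq h g) => [->//|hg].
  have u : uniq [:: f; g; h] by rewrite /= !inE negb_or fg eq_sym hf eq_sym hg.
  rewrite (chord3 Y0 vf vg vh u) (chord3 X0 vf vg vh u) ef eg.
  by rewrite (rotationN hT) (rotationD hT).
have [f0 [f1 [s0 s1 n01]]] : exists f0 f1, [/\ star v0 f0, star v0 f1 & f0 != f1].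
  have /card_gt0P[f sf] : (0 < #|star v0|)%N by rewrite card_star.
  have [g [g' [sg _ /= + _]]] := star3 (sf : star v0 f).
  by rewrite inE negb_or => /andP[/andP[nf _] _]; exists f, g.
have [T0 T0S [e0 e1]] := SU2_transitive_frames (X_nondeg s0 s1 n01)
  (chord_sqr s0) (chord_sqr s1) (chord_gram s0 s1).
set T := ad T0 in e0 e1; have hT : is_rotation T := ad_is_rotation T0S.
have start : superposed T v0.
  exact: (complete _ _ _ _ hT s0 s1 n01 (esym e0) (esym e1)).
(* As [T] is a rotation, [T y] and [T z] are independent, so that a vector is
    known from its products with them and with their cross product. *)
have superpose y z d d' : cross y z != 0 ->
    dot d' (T y) = dot d y -> dot d' (T z) = dot d z ->
    dot d' (cross (T y) (T z)) = dot d (cross y z) -> d' = T d.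
  move=> n0 h1 h2 h3; apply: (frame_ext (x := T y) (y := T z)).
  - by rewrite (rotation_cross hT) (rotation_eq0 hT).
  - by rewrite h1 (rotation_dot hT).
  - by rewrite h2 (rotation_dot hT).
  by rewrite h3 (rotation_cross hT) (rotation_dot hT).
have step v w : adj v w -> superposed T v -> superposed T w.
  move=> vw sv; have wv : adj w v by rewrite adj_sym.
  have [a avw] := edge_between vw.
  have [v1 [w1 [f [g [hg hc hs]]]]] := hh a.
  have [avw1 vf fw wg gv] := hg; have vw1 := ends_adj avw1.
  have wv1 : adj w1 v1 by rewrite adj_sym.
  have [nX nY] := chord_neq0 vw1.
  have yz : dot (chord X v1 f) (chord X w1 g) =
      dot (chord Y v1 f) (chord Y w1 g).
    move: hc; rewrite /hinge_cos /dihedral_cos hinge_axis_dot //.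
    by rewrite hinge_axis_dot_opposite //; apply: addIr.
  have xyz : dot (chord X v1 (inl w1)) (cross (chord X v1 f) (chord X w1 g)) =
      dot (chord Y v1 (inl w1)) (cross (chord Y v1 f) (chord Y w1 g)).
    move: hs; rewrite /hinge_sin /dihedral_sin /axis /normalize !dotZl.
    rewrite -/(chord X v1 (inl w1)) -/(chord Y v1 (inl w1)) same_length //.
    by apply: mulfI; rewrite invr_eq0 vnorm_eq0.
  have flip Z : \sum_i Z i = 0 ->
      chord Z w (inl v) = - chord Z v (inl w).
    by move=> Z0; exact: chord_opposite.
  have ewv : chord Y w (inl v) = T (chord X w (inl v)).
    by rewrite !flip // (rotationN hT) -sv.
  have [[ev ew]|[ev ew]] : (v1 = v /\ w1 = w) \/ (v1 = w /\ w1 = v).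
    move: avw avw1 => /andP[_ /eqP e] /andP[nvw1 /eqP].
    by rewrite e => e'; apply: set2_eq (adj_neq nvw1) (esym e').
  - subst v1 w1.
    apply: (complete T w (inl v) g) => //; first by rewrite eq_sym.
    apply: (superpose (chord X v (inl w)) (chord X v f)).
    + by apply: X_nondeg => //; rewrite eq_sym.
    + rewrite -sv // -[chord Y v _]opprK -[in RHS](opprK (chord X v (inl w))).
      by rewrite -!flip // !dotNr chord_gram.
    + by rewrite -sv // dotC -yz dotC.
    by rewrite -!sv // dot_cross_rot [RHS]dot_cross_rot xyz.
  subst v1 w1.
  apply: (complete T w (inl v) f) => //; first by rewrite eq_sym.
  apply: (superpose (chord X w (inl v)) (chord X v g)).
  + rewrite flip // crossNl oppr_eq0.
    by apply: X_nondeg => //; rewrite eq_sym.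
  + by rewrite -ewv chord_gram.
  + by rewrite -sv // -yz.
  rewrite -ewv -sv // dot_cross_rot [in RHS]dot_cross_rot.
  by rewrite [cross (chord Y v g) _]crossC [cross (chord X v g) _]crossC;
    rewrite !dotNr xyz.
have all_superposed v : superposed T v.
  have /connectP[s vs ->] := adj_connected v0 v.
  elim: s v0 start vs {s0 s1 e0 e1 n01} => //= y s IH x sx /andP[xy ys].
  exact: IH (step _ _ xy sx) ys.
exists T => // i; have := all_superposed (Defs.half G i) (inr i).
by rewrite /= eqxx /chord /vsum /= !big_set1; apply.
Qed.

End SameLengths.

End Hinges.

(** * The action on the regular part *)

Section HingeAngles.
Import boot.fintype boot.finset.
Variables (R : realType) (n : nat) (G : admissible_graph n) (ell : 'I_n -> R).
Hypothesis ell_gt0 : forall i, 0 < ell i.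
Variable i0 : 'I_n.
Local Notation space := (polygon_space ell).
Implicit Types (x y : closed_polygon ell) (p q : space) (v w : vertex G)
  (f g : flag G) (a b : Eint G) (s t : R).

Lemma class_hinge x y v w f g : polygon_class x = polygon_class y ->
  hinge_cos v w f g (pv x) = hinge_cos v w f g (pv y) /\
  hinge_sin v w f g (pv x) = hinge_sin v w f g (pv y).
Proof.
move=> /class_eq_is_rotation[T hT /funext ->].
by have [-> ->] := hinge_rotation v w f g (pv x) hT.
Qed.

Definition class_cos v w f g p := hinge_cos v w f g (pv (repr p)).
Definition class_sin v w f g p := hinge_sin v w f g (pv (repr p)).

Lemma class_cosE v w f g x :
  class_cos v w f g (polygon_class x) = hinge_cos v w f g (pv x).
Proof. exact (class_hinge v w f g (class_repr (polygon_class x))).1. Qed.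

Lemma class_sinE v w f g x :
  class_sin v w f g (polygon_class x) = hinge_sin v w f g (pv x).
Proof. exact (class_hinge v w f g (class_repr (polygon_class x))).2. Qed.

Lemma hinge_Phi_self a v w f g t p : hinge a v w f g -> Mstar G ell p ->
  class_cos v w f g (Phi a t p) =
    cos t * class_cos v w f g p - sin t * class_sin v w f g p /\
  class_sin v w f g (Phi a t p) =
    cos t * class_sin v w f g p + sin t * class_cos v w f g p.
Proof.
move=> hg; rewrite -(class_repr p) => /(Mstar_regular G ell_gt0 i0) rx.
have [avw _ _ _ _] := hg; have vw := ends_adj avw.
rewrite (Phi_class t avw rx) !class_cosE !class_sinE.
rewrite (funext (pv_bend_tips t rx vw)).
exact: hinge_bend_self hg (rx.2 _ _ vw).
Qed.

Lemma hinge_Phi_other a b v w f g t p : hinge a v w f g -> a != b ->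
  Mstar G ell p ->
  class_cos v w f g (Phi b t p) = class_cos v w f g p /\
  class_sin v w f g (Phi b t p) = class_sin v w f g p.
Proof.
move=> hg ab; rewrite -(class_repr p) => /(Mstar_regular G ell_gt0 i0) rx.
have [avw _ _ _ _] := hg; have [v' [w' [bvw vb wb]]] := other_edge_side avw ab.
have vw' := ends_adj bvw.
rewrite (Phi_class t bvw rx) !class_cosE !class_sinE.
rewrite (funext (pv_bend_tips t rx vw')).
exact: hinge_bend_away hg (rx.2 _ _ vw') vb wb.
Qed.

(** Among the flows composed in [flow r tau], only that of [a] acts on a hinge
    at [a]. *)
Lemma hinge_flow a v w f g (r : seq (Eint G)) (tau : Eint G -> R) p :
  hinge a v w f g -> Mstar G ell p -> uniq r ->
  let t := if a \in r then tau a else 0 in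
  class_cos v w f g (flow r tau p) =
    cos t * class_cos v w f g p - sin t * class_sin v w f g p /\
  class_sin v w f g (flow r tau p) =
    cos t * class_sin v w f g p + sin t * class_cos v w f g p.
Proof.
move=> hg Mp; elim: r => [|b r IH] /=.
  by rewrite cos0 sin0 !mul1r !mul0r subr0 addr0.
move=> /andP[br ur]; rewrite inE; have Mr := flow_Mstar ell_gt0 i0 r tau Mp.
have [IHc IHs] := IH ur.
case: (eqVneq a b) => [ab|ab] /=; last first.
  by have [-> ->] := hinge_Phi_other (tau b) hg ab Mr.
have ar : a \notin r by rewrite ab.
move: IHc IHs; rewrite (negbTE ar) cos0 sin0 !mul1r !mul0r subr0 addr0 => IHc IHs.
by rewrite -ab; have [-> ->] := hinge_Phi_self (tau a) hg Mr; rewrite IHc IHs.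
Qed.

End HingeAngles.

Section RegularPart.
Import boot.fintype boot.finset.
Variables (R : realType) (n : nat) (G : admissible_graph n) (ell : 'I_n -> R).
Hypothesis n_ge4 : (4 <= n)%N.
Hypothesis ell_gt0 : forall i, 0 < ell i.
Local Notation space := (polygon_space ell).
Implicit Types (x y : closed_polygon ell) (p q : space) (v w : vertex G)
  (f g : flag G) (a b : Eint G) (s t : R).

Definition flag_edge v f (e : edge G) : Prop :=
  match f, e with
  | inl w, inl a => is_true (ends a v w)
  | inr i, inr j => i = j
  | _, _ => False
  end.

Lemma flag_edge_exists v f : star v f -> exists e, flag_edge v f e.
Proof.
case: f => [w vw|i _]; last by exists (inr i).
by have [a avw] := edge_between vw; exists (inl a).
Qed.

Lemma flag_edge_inj v f g e : flag_edge v f e -> flag_edge v g e -> f = g.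
Proof.
case: f g e => [w|i] [w'|j] [a|k] //=; last by move=> -> ->.
move=> /andP[vw /eqP e] /andP[vw' /eqP e'].
have [[_ ->//]|[ev ew]] := set2_eq (adj_neq vw) (etrans (esym e) e').
by rewrite ew ev.
Qed.

Lemma flag_edge_incident v f e : star v f -> flag_edge v f e -> incident v e.
Proof.
case: f e => [w|i] [a|k] //= vf; last by move=> <-; exact/eqP.
by move=> /andP[_ /eqP ->]; rewrite set21.
Qed.

Lemma flag_edge_length x v f e : flag_edge v f e ->
  vnorm (chord (pv x) v f) =
  edge_length ell (fun a => lambda a (polygon_class x)) e.
Proof.
case: f e => [w|i] [a|k] //=; first by move=> avw; rewrite (lambda_chord x avw).
by move=> <-; rewrite /chord /vsum /= big_set1; have [-> _] := pv_closed_up x.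
Qed.

(** Otherwise the three edges at [v] would be half-edges; a further half-edge
    would have another endpoint, which connectedness joins to [v]. *)
Lemma neighbour_exists v : exists w, adj v w.
Proof.
have /subsetPn[i _ iv] : ~~ ([set: 'I_n] \subset [set i | Defs.half G i == v])%SET.
  apply/negP => /subset_leq_card; rewrite cardsT card_ord.
  have := trivalent v; set A := #|_|; set B := #|_| => AB.
  by move=> nB; have := leq_trans n_ge4 (leq_trans nB (leq_addl A B)); rewrite AB.
rewrite inE in iv; have [w vw _] := branch_exists iv.
by exists w.
Qed.

Lemma edge_length_dfwith (d : Eint G -> R) a s e :
  edge_length ell (dfwith d a s : Eint G -> R) e =
  if e == inl a then s else edge_length ell d e.
Proof.
case: e => [b|i] //=; rewrite (inj_eq inl_inj).
by case: (eqVneq b a) => [->|ba]; rewrite ?dfwithin // dfwithout // eq_sym.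
Qed.

(** At an interior point of [Delta], the coordinate of an internal edge can be
    both increased and decreased. *)
Lemma strict_triangle x v w f g : Mreg G ell (polygon_class x) ->
  adj v w -> star v f -> star v g -> uniq [:: inl w; f; g] ->
  `|vnorm (chord (pv x) v f) - vnorm (chord (pv x) v g)|
    < vnorm (chord (pv x) v (inl w)) <
  vnorm (chord (pv x) v f) + vnorm (chord (pv x) v g).
Proof.
move=> Mx vw vf vg /=; rewrite !inE negb_or andbT => /andP[/andP[wf wg] fg].
have [a avw] := edge_between vw.
have [ef hef] := flag_edge_exists vf; have [eg heg] := flag_edge_exists vg.
have hea : flag_edge v (inl w) (inl a) by [].
rewrite (flag_edge_length x hef) (flag_edge_length x heg) (flag_edge_length x hea).
set d := fun a => lambda a _ in Mx *; move: Mx; rewrite /Mreg /= -/d => Mx.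
have [e e0 he] := interior_coordinate a Mx.
have nef : ef <> inl a.
  by move=> h; rewrite h in hef; rewrite (flag_edge_inj hef hea) eqxx in wf.
have neg : eg <> inl a.
  by move=> h; rewrite h in heg; rewrite (flag_edge_inj heg hea) eqxx in wg.
have nfg : ef <> eg.
  by move=> h; rewrite h in hef; rewrite (flag_edge_inj hef heg) eqxx in fg.
have ineq s : `|s - d a| < e ->
    `|edge_length ell d ef - edge_length ell d eg| <= s
      <= edge_length ell d ef + edge_length ell d eg.
  move=> /he[_ /(_ v ef eg (inl a))]; rewrite !edge_length_dfwith eqxx.
  rewrite (negbTE (introN eqP nef)) (negbTE (introN eqP neg)); apply => //.
  - exact: flag_edge_incident hef.
  - exact: flag_edge_incident heg.
  exact: (flag_edge_incident (vw : star v (inl w)) hea).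
have e2 : 0 < e / 2 by rewrite divr_gt0 // ltr0n.
have ee : e / 2 < e by rewrite ltr_pdivrMr ?ltr0n // ltr_pMr // ltr1n.
have a1 : `|d a - e / 2 - d a| < e.
  by rewrite addrAC subrr add0r normrN gtr0_norm.
have a2 : `|d a + e / 2 - d a| < e by rewrite addrAC subrr add0r gtr0_norm.
have /andP[h1 _] := ineq _ a1; have /andP[_ h2] := ineq _ a2.
apply/andP; split; first by apply: le_lt_trans h1 _; rewrite ltrBlDr ltrDl.
by apply: lt_le_trans h2; rewrite ltrDl.
Qed.

(** Each vertex has an internal edge, to which [strict_triangle] applies; the
    cross products of the pairs of sides of a triangle agree up to sign. *)
Lemma Mreg_nonflat x : Mreg G ell (polygon_class x) ->
  nonflat G (pv x).
Proof.
move=> Mx v; have [w vw] := neighbour_exists v.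
have X0 := pv_sum x.
have [f1 [f2 [s1 s2 u hall]]] := star3 (vw : star v (inl w)).
have u' : uniq [:: f1; f2; inl w].
  by move: u; rewrite -(rot_uniq 1).
have e0 := chord3 X0 s1 s2 (vw : star v (inl w)) u'.
set y1 := chord (pv x) v f1 in e0 *; set y2 := chord (pv x) v f2 in e0 *.
have n12 : cross y1 y2 != 0.
  have := strict_triangle Mx vw s1 s2 u.
  rewrite e0 vnormN -/y1 -/y2.
  have := vnorm_sqr y1; have := vnorm_sqr y2; have := vnorm_sqr (y1 + y2).
  have := cross_sqr y1 y2; rewrite !dotDl !dotDr (dotC y2 y1).
  have := vnorm_ge0 y1; have := vnorm_ge0 y2; have := vnorm_ge0 (y1 + y2).
  move: (vnorm y1) (vnorm y2) (vnorm (y1 + y2)) (dot y1 y2) => l1 l2 l0 c.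
  move=> p0 p2 p1 hc q0 q2 q1; rewrite ltr_norml => /andP[/andP[t1 t2] t3].
  rewrite -dot_eq0 hc -q1 -q2.
  have c1 : c < l1 * l2 by nra.
  have c2 : - (l1 * l2) < c by nra.
  by rewrite gt_eqF //; nra.
have n21 : cross y2 y1 != 0 by rewrite crossC oppr_eq0.
move=> f g vf vg; have := hall _ vf; have := hall _ vg.
rewrite !inE => /or3P[]/eqP-> /or3P[]/eqP->; rewrite ?eqxx // => _;
  rewrite ?e0 -?/y1 -?/y2 //.
- by rewrite crossNr crossDr crossvv add0r oppr_eq0.
- by rewrite crossNr crossDr crossvv addr0 oppr_eq0.
- by rewrite crossNl crossDl crossvv add0r oppr_eq0.
by rewrite crossNl crossDl crossvv addr0 oppr_eq0.
Qed.

Lemma noncollinear_of_vsum (X : 'I_n -> vec R) I J :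
  cross (vsum I X) (vsum J X) != 0 -> exists j k, cross (X j) (X k) != 0.
Proof.
move=> n0; apply: contrapT => h.
have c0 j k : cross (X j) (X k) = 0.
  by apply: contrapT => /eqP njk; apply: h; exists j, k.
move: n0; rewrite cross_sumr big1 ?eqxx // => k _.
by rewrite crossC cross_sumr big1 ?oppr0 // => j _; exact: c0.
Qed.

(** The edges of a polygon with a non-flat triangle are not collinear, and the
    sides of a non-flat triangle do not vanish. *)
Lemma Mreg_Mstar (i0 : 'I_n) p : Mreg G ell p -> Mstar G ell p.
Proof.
rewrite -(class_repr p) => /Mreg_nonflat nd.
apply/(Mstar_regular G ell_gt0 i0).
have third v f : star v f ->
    exists2 g, star v g & cross (chord (pv (repr p)) v f) (chord (pv (repr p)) v g) != 0.
  move=> vf; have [g [g' [vg _ /= + _]]] := star3 vf.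
  rewrite inE negb_or => /andP[/andP[nf _] _].
  by exists g => //; apply: nd.
split=> [|v w vw].
  have [w vw] := neighbour_exists (Defs.half G i0).
  have [g _] := third _ (inl w) vw; exact: noncollinear_of_vsum.
by have [g _ /cross_neq0_l] := third v (inl w) vw.
Qed.

Lemma Mreg_lambda p q : Mreg G ell p ->
  (forall a : Eint G, lambda a q = lambda a p) -> Mreg G ell q.
Proof.
move=> h /funext e; rewrite /Mreg /= e; exact h.
Qed.

Lemma same_lambda_chord x y v f :
  (forall a : Eint G, lambda a (polygon_class x) = lambda a (polygon_class y)) ->
  star v f -> vnorm (chord (pv x) v f) = vnorm (chord (pv y) v f).
Proof.
move=> e vf; have [ed hed] := flag_edge_exists vf.
rewrite (flag_edge_length x hed) (flag_edge_length y hed).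
by case: ed {hed} => [a|i] /=.
Qed.

End RegularPart.

Theorem theorem4p2 (R : realType) (n : nat) (hn : (4 <= n)%N)
    (G : admissible_graph n) (ell : 'I_n -> R)
    (ell_gt0 : forall i, 0 < ell i)
    (ell_lt : forall j, ell j < 2^-1 * \sum_i ell i) :
  exists Phi : Eint G -> R -> polygon_space ell -> polygon_space ell,
    (forall a, hamiltonian_flow (Mstar G ell)
                 (fun p => 2^-1 * lambda a p) (Phi a)) /\
    (forall a b s t p, Mstar G ell p ->
       Phi a s (Phi b t p) = Phi b t (Phi a s p)) /\
    (forall a t p, Mstar G ell p -> Phi a (t + 2 * pi) p = Phi a t p) /\
    exists act : {ffun Eint G -> circle R} ->
                 polygon_space ell -> polygon_space ell,
      (forall g p, Mstar G ell p -> Mstar G ell (act g p)) /\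
      (forall p, Mstar G ell p -> act 0 p = p) /\
      (forall g h p, Mstar G ell p -> act (g + h) p = act g (act h p)) /\
      (forall a t p, Mstar G ell p -> act (torus_coord a t) p = Phi a t p) /\
      (forall g p, Mreg G ell p -> act g p = p -> g = 0) /\
      (forall p, Mreg G ell p ->
         [set q | Mreg G ell q /\ forall a : Eint G, lambda a q = lambda a p] =
         [set act g p | g in [set: {ffun Eint G -> circle R}]]).
Proof.
have i0 : 'I_n by case: n hn {G ell ell_gt0 ell_lt} => // m _; exact: ord0.
exists (@Phi R n G ell); split; first exact (Phi_hamiltonian ell_gt0 i0).
split; first exact (fun a b s t p => @Phi_comm _ _ _ _ ell_gt0 i0 a b s t p).
split; first exact (fun a t p => @Phi_periodic _ _ _ _ ell_gt0 i0 a t p).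
exists (@act R n G ell).
split; first exact (fun g p => @act_Mstar _ _ _ _ ell_gt0 i0 g p).
split; first exact (fun p => @act0 _ _ _ _ ell_gt0 i0 p).
split; first exact (fun g h p => @actD _ _ _ _ ell_gt0 i0 g h p).
split; first exact (fun a t p => @act_torus_coord _ _ _ _ ell_gt0 i0 a t p).
split.
  move=> g p Mp fixed; have Mps := Mreg_Mstar hn ell_gt0 i0 Mp.
  apply/ffunP => a; rewrite ffunE.
  have [v [w [f [h hg]]]] := hinge_exists a.
  have nd := Mp; rewrite -(class_repr p) in nd.
  have {}nd := Mreg_nonflat hn nd.
  have [r0 _] := hinge_radius (pv_sum (repr p)) (pv_sum (repr p))
    (fun _ _ _ => erefl) nd nd hg.
  have := hinge_flow ell_gt0 i0 (fun a => repr (g a)) hg Mps (enum_uniq (Eint G)).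
  rewrite mem_enum /= -/(act g p) fixed => -[hc hs].
  rewrite -(to_circle_repr (g a)).
  exact (rotation_fixed_point r0 (esym hc) (esym hs)).
move=> p Mp; have Mps := Mreg_Mstar hn ell_gt0 i0 Mp.
apply/seteqP; split=> [q [Mq lq]|_ [g _ <-]]; last first.
  have lg a := lambda_flow ell_gt0 i0 a (enum (Eint G)) (fun b => repr (g b)) Mps.
  by split; [exact (Mreg_lambda Mp lg)|exact lg].
have ndp := Mp; rewrite -(class_repr p) in ndp.
have {}ndp := Mreg_nonflat hn ndp.
have ndq := Mq; rewrite -(class_repr q) in ndq.
have {}ndq := Mreg_nonflat hn ndq.
have lpq (v : vertex G) f : star v f ->
    vnorm (chord (pv (repr p)) v f) = vnorm (chord (pv (repr q)) v f).
  by apply: same_lambda_chord => a; rewrite !class_repr; exact (esym (lq a)).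
(* The hinges of [p] and [q] at [a] have the same radius, hence differ by an
    angle [tau a]. *)
have /choice[tau htau] : forall a : Eint G, exists t, exists v w f h, [/\ hinge a v w f h,
    cos t * class_cos v w f h p - sin t * class_sin v w f h p
      = class_cos v w f h q &
    cos t * class_sin v w f h p + sin t * class_cos v w f h p
      = class_sin v w f h q].
  move=> a; have [v [w [f [h hg]]]] := hinge_exists a.
  have [r0 r1] := hinge_radius (pv_sum (repr p)) (pv_sum (repr q)) lpq ndp ndq hg.
  have [t [h1 h2]] := rotation_transitive r0 r1.
  by exists t, v, w, f, h.
exists [ffun a => to_circle (tau a)] => //.
have -> : act [ffun a => to_circle (tau a)] p = flow (enum (Eint G)) tau p.
  by apply: (act_to_circle ell_gt0 i0 Mps) => a; rewrite ffunE.
set p' := flow _ _ _.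
have lp' a : lambda a p' = lambda a p := lambda_flow ell_gt0 i0 a _ tau Mps.
have Mp' : Mreg G ell p' := Mreg_lambda Mp lp'.
have ndp' := Mp'; rewrite -(class_repr p') in ndp'.
have {}ndp' := Mreg_nonflat hn ndp'.
have lp'q (v : vertex G) f : star v f ->
    vnorm (chord (pv (repr p')) v f) = vnorm (chord (pv (repr q)) v f).
  by apply: same_lambda_chord => a; rewrite !class_repr lp'; exact (esym (lq a)).
have [|T hT e] := rigidity (pv_sum (repr p')) (pv_sum (repr q)) lp'q ndp' ndq
  (Defs.half G i0).
  move=> a; have [v [w [f [h [hg hc hs]]]]] := htau a.
  have := hinge_flow ell_gt0 i0 tau hg Mps (enum_uniq (Eint G)).
  rewrite mem_enum /= -/p' hc hs => -[hc' hs'].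
  by exists v, w, f, h.
rewrite -(class_repr p') -(class_repr q).
exact (class_eq_rotation hT e).
Qed.
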